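(* There exists an absolute constant $\epsilon_0>0$ such that for every $\epsilon\in(0,\epsilon_0]$ there exist constants $c_\epsilon>0$ and $d_\epsilon\in\mathbb{N}$ with the following property. For every dimension $d\ge d_\epsilon$, every sample size $N\le c_\epsilon d^2$, and every (possibly randomized) test $f:(\mathbb{R}^d)^N\to\{0,1\}$, it is NOT the case that both of the following hold: (i) $\Pr_{x\sim \mathcal{N}(0,I_d)^{\otimes N}}[f(x)=0]\ge 2/3$; and (ii) for every positive definite symmetric $d\times d$ matrix $\Sigma$ with $\|\Sigma-I_d\|_F>1/2$ and every probability distribution $B$ on $\mathbb{R}^d$, $\Pr_{x\sim Z^{\otimes N}}[f(x)=1]\ge 2/3$, where $Z=(1-\epsilon)\mathcal{N}(0,\Sigma)+\epsilon B$. In other words, distinguishing $\mathcal{N}(0,I_d)$ from $\epsilon$-contaminated Gaussians $(1-\epsilon)\mathcal{N}(0,\Sigma)+\epsilon B$ with $\|\Sigma-I\|_F>1/2$ requires $\Omega(d^2)$ i.i.d. samples.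
   Context: $\mathcal{N}(\mu,\Sigma)$ denotes the Gaussian distribution on $\mathbb{R}^d$ with mean $\mu$ and covariance $\Sigma$; $\|\cdot\|_F$ is the Frobenius norm; $D^{\otimes N}$ denotes the distribution of $N$ i.i.d. samples from $D$. The mixture $(1-\epsilon)P+\epsilon Q$ is the distribution that samples from $P$ with probability $1-\epsilon$ and from $Q$ with probability $\epsilon$. *)

(* Defs.v *)
From HB Require Import structures.
From mathcomp Require Import all_boot all_order all_algebra.
From mathcomp Require Import all_classical all_reals all_analysis.

Set Implicit Arguments.
Unset Strict Implicit.
Unset Printing Implicit Defensive.

Import Order.TTheory GRing.Theory Num.Theory.
Import numFieldNormedType.Exports.

Local Open Scope classical_set_scope.
Local Open Scope ring_scope.

(** Points of R^d are d-tuples of reals, with the product (= Borel)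
    sigma-algebra provided by MathComp-Analysis on [n.-tuple T]. *)
Notation Rvec R d := (d.-tuple R).

Definition colv {R : realType} {d : nat} (x : Rvec R d) : 'cV[R]_d :=
  \col_i tnth x i.

Definition posdef {R : realType} {d : nat} (S : 'M[R]_d) : Prop :=
  S^T = S /\ forall v : 'cV[R]_d, v != 0 -> 0 < (v^T *m S *m v) ord0 ord0.

Definition frob {R : realType} {m n : nat} (A : 'M[R]_(m, n)) : R :=
  Num.sqrt (\sum_i \sum_j (A i j) ^+ 2).

Definition gauss_density {R : realType} {d : nat} (S : 'M[R]_d) (x : Rvec R d) : R :=
  (Num.sqrt ((pi *+ 2) ^+ d * \det S))^-1 *
  expR (- ((colv x)^T *m invmx S *m colv x) ord0 ord0 / 2).

Local Open Scope ereal_scope.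

(** An "integration functional" [I] on T (non-negative integrands) is
    lifted to the n-fold product: [prod_int I n h] is the iterated integral
    of [h : n.-tuple T -> \bar R] against the n-fold product of I.
    For I the integral of a probability measure P and h non-negative
    measurable this is (by Tonelli) the integral of h against P^{(x) n}. *)
Fixpoint prod_int {R : realType} {T : Type} (I : (T -> \bar R) -> \bar R)
    (n : nat) : (n.-tuple T -> \bar R) -> \bar R :=
  match n return (n.-tuple T -> \bar R) -> \bar R with
  | 0 => fun h => h [tuple]
  | n'.+1 => fun h => I (fun x => @prod_int R T I n' (fun t => h (cons_tuple x t)))
  end.
Arguments prod_int {R T} I n h.

Definition gauss_int {R : realType} {d : nat} (S : 'M[R]_d)
    (g : Rvec R d -> \bar R) : \bar R :=
  prod_int (fun h : R -> \bar R => \int[@lebesgue_measure R]_x h x) d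
    (fun x => g x * (gauss_density S x)%:E).

Definition contam_int {R : realType} {d : nat} (eps : R) (S : 'M[R]_d)
    (B : probability (Rvec R d) R) (g : Rvec R d -> \bar R) : \bar R :=
  (1 - eps)%:E * gauss_int S g + eps%:E * \int[B]_x g x.

(* Main.v *)
(** Draw a random symmetric sign matrix [A] with entries [+- 1 / d], so that
    [||A||_F = 1], conditioned on [||A^2||_F^2 <= 4 / d]. The alternative is the
    mixture [sum_k w_k N(0, I + s_k A)] with [w_0 = 1 - eps] and [s_0 = 1]; the
    contamination supplies the other three atoms, chosen so that the first and
    third moments of the [s_k] under the weights [w_k] vanish. For two draws [A]
    and [A'] the likelihood ratios against [N(0, I)] have correlation
    [rho(A, A') = sum_(k, l) w_k w_l det(I - s_k s_l A A')^(-1/2)], and expanding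
    the determinant gives
    [rho <= 1 + C t_1^2 + C' t_2 + C'' / d^2] with [t_1 = tr(A A')] and
    [t_2 = tr(A A' A A')]. Since [d^2 (C t_1^2 + C' t_2)] is a Rademacher chaos
    of degree two with bounded exponential moment, the mean of [rho^N] is close
    to 1 as long as [N <= c d^2], and the second moment method applies. *)

Require Import Defs.
From HB Require Import structures.
From mathcomp Require Import all_boot all_order all_algebra.
From mathcomp Require Import all_classical all_reals all_analysis.
From mathcomp Require Import measurable_realfun normal_distribution.
From mathcomp Require Import spectral complex.
From mathcomp Require Import ring lra.
Import Order.TTheory GRing.Theory Num.Theory.
Import numFieldNormedType.Exports.
Local Open Scope classical_set_scope.
Local Open Scope ring_scope.

Set Implicit Arguments.
Unset Strict Implicit.
Unset Printing Implicit Defensive.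

(** * Product measures and the second moment method *)

(** Without contamination the correlation of two alternatives would contain a multiple of [t_1], of
    typical size [1 / d], and the argument would only reach order [d] samples. The contamination is
    spent on odd moments: the first removes [t_1], the third removes the trace of [(A A')^3]. The
    second moment of the [s_k] is positive and cannot be cancelled, but [t_2] is typically of size
    [1 / d^2], which fits the target. The condition on [A^2] makes the expansion uniform. It bounds
    the operator norm of [A] by [(4 / d)^(1/4)], so that for large [d] the covariances are positive
    definite and the correlations finite, and it bounds the squared Frobenius norm of [A A'] by
    [4 / d], so that the remainder is [O(t_1^2 + 1 / d^2)]. It spoils the independence of the signs;
    but at least half of them survive, and a sum of positive terms over the good matrices can be
    enlarged to all of them. Signs, rather than Gaussian entries, make the prior a finite average
    with no measure on matrices, fix the Frobenius norm exactly, and keep the coefficients of the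
    chaos uniformly small. *)

Lemma exists_product_probability (d : measure_display) (T : measurableType d)
    (R : realType) (P : probability T R) (n : nat) :
  exists Q : probability (n.-tuple T) R, forall h : n.-tuple T -> \bar R,
    measurable_fun [set: n.-tuple T] h -> (forall x, 0 <= h x)%E ->
    (\int[Q]_x h x)%E = prod_int (fun g => \int[P]_x g x)%E n h.
Proof.
elim: n => [|n [Q IH]].
  exists (dirac [tuple] : probability _ _) => h mh h0 /=.
  by rewrite integral_dirac// diracT mul1e.
have mcons : measurable_fun [set: T * n.-tuple T]
    (fun z : T * n.-tuple T => cons_tuple z.1 z.2).
  by apply: measurable_cons.
pose f (z : T * n.-tuple T) := cons_tuple z.1 z.2.
have mf : measurable_fun setT f by [].
(* The image of [P \x Q] under cons; Tonelli then matches the recursion of [prod_int]. *)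
pose PQ : {measure set (n.+1.-tuple T) -> \bar R} :=
  measure_function_pushforward__canonical__measure_function_Measure (P \x Q)%E mf.
have PQT : PQ setT = 1%E.
  rewrite /PQ /= /pushforward preimage_setT -setXTT product_measure1E//.
  by rewrite -[RHS]mule1; congr (_ * _)%E; exact: probability_setT.
pose mix := @Measure_isProbability.Build _ _ R PQ PQT.
pose Pr : probability (n.+1.-tuple T) R := HB.pack (PQ : set _ -> \bar R) PQ mix.
exists Pr => h mh h0.
have mhc := measurableT_comp mh mcons.
rewrite [LHS](_ : _ = (\int[pushforward (P \x Q)%E f]_x h x)%E)//.
rewrite ge0_integral_pushforward//.
rewrite preimage_setT fubini_tonelli1//=.
apply: eq_integral => x _; rewrite /fubini_F -IH//=.
apply: measurableT_comp => //; apply: measurable_cons => //.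
Qed.

Lemma exists_density_probability (d : measure_display) (T : measurableType d)
    (R : realType) (P : {sigma_finite_measure set T -> \bar R}) (h : T -> R) :
  measurable_fun setT h -> (forall x, 0 <= h x) ->
  (\int[P]_x (h x)%:E = 1)%E ->
  exists B : probability T R, forall g : T -> \bar R,
    measurable_fun setT g -> (forall x, 0 <= g x)%E ->
    (\int[B]_x g x = \int[P]_x (g x * (h x)%:E))%E.
Proof.
move=> mh h0 h1.
have mh' : measurable_fun setT (EFin \o h) by exact/measurable_EFinP.
pose nu (A : set T) : \bar R := (\int[P]_(x in A) (h x)%:E)%E.
have nu0 : nu set0 = 0%E by rewrite /nu integral_set0.
have nu_ge0 A : (0 <= nu A)%E.
  by apply: integral_ge0 => x _; rewrite lee_fin.
have ih : P.-integrable setT (EFin \o h).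
  apply/integrableP; split => //.
  by under eq_integral do rewrite /= ger0_norm//; rewrite h1 ltry.
have nu_add : semi_sigma_additive nu.
  move=> /= A mA tA mUA; rewrite /nu/= integral_bigcup//=; last first.
    exact: (integrableS _ _ (subsetT _)).
  apply: is_cvg_ereal_nneg_natsum_cond => k _ _.
  by apply: integral_ge0 => /= x ?; rewrite lee_fin.
pose mixm := isMeasure.Build _ _ _ nu nu0 nu_ge0 nu_add.
pose num : {measure set T -> \bar R} := HB.pack nu mixm.
pose mixp := @Measure_isProbability.Build _ _ R num h1.
pose B : probability T R := HB.pack nu num mixp.
exists B => g mg g0.
(* Change of variables is available for the Radon-Nikodym derivative of [B], which agrees with [h]
   only almost everywhere. *)
have BP : B `<< P.
  apply/null_content_dominatesP => A mA PA0.
  apply: null_set_integral => //; exact: measurable_funTS.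
rewrite -(Radon_Nikodym_SigmaFinite.change_of_variables BP g0)//.
have mf : measurable_fun setT (Radon_Nikodym_SigmaFinite.f B P).
  exact: measurable_int (Radon_Nikodym_SigmaFinite.f_integrable BP).
apply: ge0_ae_eq_integral => //.
- exact: emeasurable_funM.
- exact: emeasurable_funM.
- by move=> x _; rewrite mule_ge0// Radon_Nikodym_SigmaFinite.f_ge0.
- by move=> x _; rewrite mule_ge0// lee_fin.
suff : ae_eq P setT (Radon_Nikodym_SigmaFinite.f B P) (EFin \o h).
  by apply: filterS => x /= fh _; rewrite fh.
apply: integral_ae_eq => //.
  exact: Radon_Nikodym_SigmaFinite.f_integrable.
by move=> E _ mE; rewrite -Radon_Nikodym_SigmaFinite.f_integral.
Qed.

(** Since [I] is known only on measurable non-negative integrands, the induction has to check each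
    partial integral. Besides likelihood ratios, [L] will also be the reciprocal of the normal
    density, which turns iterated Lebesgue integrals into integrals against a probability. *)
Lemma prod_int_density (d : measure_display) (T : measurableType d)
    (R : realType) (P : probability T R) (L : T -> R)
    (I : (T -> \bar R) -> \bar R) :
  measurable_fun setT L -> (forall x, 0 <= L x) ->
  (forall g : T -> \bar R, measurable_fun setT g -> (forall x, 0 <= g x)%E ->
     I g = \int[P]_x (g x * (L x)%:E))%E ->
  forall (n : nat) (Q : probability (n.-tuple T) R),
  (forall h : n.-tuple T -> \bar R, measurable_fun [set: n.-tuple T] h ->
     (forall x, 0 <= h x)%E ->
     \int[Q]_x h x = prod_int (fun g => \int[P]_x g x) n h)%E ->
  forall h : n.-tuple T -> \bar R, measurable_fun [set: n.-tuple T] h ->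
    (forall x, 0 <= h x)%E ->
  (prod_int I n h = \int[Q]_x (h x * (\prod_(i < n) L (tnth x i))%:E))%E.
Proof.
move=> mL L0 IE; have mLn n : measurable_fun [set: n.-tuple T]
    (fun x : n.-tuple T => (\prod_(i < n) L (tnth x i))%:E).
  apply/measurable_EFinP; apply: measurable_prod => i _.
  by apply: measurableT_comp => //; exact: measurable_tnth.
have Ln0 n (x : n.-tuple T) : (0 <= (\prod_(i < n) L (tnth x i))%:E)%E.
  by rewrite lee_fin prodr_ge0.
elim=> [|n IH] Q QE h mh h0.
  rewrite QE/=.
  - by rewrite big_ord0 mule1.
  - by apply: emeasurable_funM => //; exact: mLn.
  - by move=> x; apply: mule_ge0 => //; exact: Ln0.
have [Qn QnE] := exists_product_probability P n.
have mhc : measurable_fun setT (fun z : T * n.-tuple T => h (cons_tuple z.1 z.2)).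
  by apply: (measurableT_comp mh); exact: measurable_cons.
have mhx x : measurable_fun setT (fun t : n.-tuple T => h (cons_tuple x t)).
  by apply: (measurableT_comp mh); exact: measurable_cons.
rewrite QE/=; first last.
- by move=> x; apply: mule_ge0 => //; exact: Ln0.
- by apply: emeasurable_funM => //; exact: mLn.
pose k (z : T * n.-tuple T) := (h (cons_tuple z.1 z.2) *
  (\prod_(i < n) L (tnth z.2 i))%:E)%E.
have mk : measurable_fun setT k.
  apply: emeasurable_funM => //.
  by apply: (measurableT_comp (mLn n)).
have k0 z : (0 <= k z)%E by apply: mule_ge0 => //; exact: Ln0.
transitivity (I (fun x => \int[Qn]_t k (x, t))%E).
  by congr I; apply/funext => x; rewrite (IH Qn).
have mFk := measurable_fun_fubini_tonelli_F (m2 := Qn) k mk k0.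
rewrite IE//; last by move=> x; exact: integral_ge0.
apply: eq_integral => x _.
rewrite -QnE; first last.
- by move=> t; apply: mule_ge0 => //; exact: Ln0.
- apply: emeasurable_funM => //.
  by apply: (measurableT_comp (mLn n.+1)); exact: measurable_cons.
rewrite -ge0_integralZr//; last 2 first.
- exact: (measurableT_comp mk).
- by rewrite lee_fin.
apply: eq_integral => t _; rewrite /k /= -muleA -EFinM; congr (_ * _%:E)%E.
rewrite big_ord_recl mulrC; congr (_ * _); apply: eq_bigr => i _.
by rewrite tnthS.
Qed.

Lemma prod_int_cst (R : realType) (T : Type) (I : (T -> \bar R) -> \bar R)
    (r : R) (n : nat) :
  (forall c : R, 0 <= c -> I (fun=> c%:E) = (c * r)%:E) -> 0 <= r ->
  forall c : R, 0 <= c -> prod_int I n (fun=> c%:E) = (c * r ^+ n)%:E.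
Proof.
move=> Ic r0; elim: n => [|n IH] c c0 /=; first by rewrite mulr1.
rewrite (_ : (fun _ => _) = fun=> (c * r ^+ n)%:E); last first.
  by apply/funext => x; rewrite IH.
by rewrite Ic ?mulr_ge0 ?exprn_ge0// exprSr mulrA.
Qed.

(* The test statistic is compared with the likelihood ratio [Lam] of the
   mixture through [f Lam + Lam <= (Lam ^+ 2 + 1 + 3 f) / 2], valid for [f] in
   [0, 1]: it is affine in [f] and an instance of AM-GM at both endpoints. *)
Lemma second_moment_method (d : measure_display) (T : measurableType d)
    (R : realType) (P : probability T R) (V : Type) (s : seq V)
    (L : V -> T -> R) (I0 : (T -> \bar R) -> \bar R)
    (I : V -> (T -> \bar R) -> \bar R) (rho : V -> V -> R) (N : nat)
    (f : N.-tuple T -> R) :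
  (forall v, measurable_fun setT (L v)) -> (forall v x, 0 <= L v x) ->
  (forall v, \int[P]_x (L v x)%:E = 1)%E ->
  (forall g : T -> \bar R, measurable_fun setT g -> (forall x, 0 <= g x)%E ->
     I0 g = \int[P]_x g x)%E ->
  (forall v (g : T -> \bar R),
     measurable_fun setT g -> (forall x, 0 <= g x)%E ->
     I v g = \int[P]_x (g x * (L v x)%:E))%E ->
  (forall v w, \int[P]_x (L v x * L w x)%:E = (rho v w)%:E)%E ->
  (forall v w, 0 <= rho v w) ->
  (0 < size s)%N ->
  \sum_(v <- s) \sum_(w <- s) rho v w ^+ N < 4 / 3 * (size s)%:R ^+ 2 ->
  measurable_fun [set: N.-tuple T] f -> (forall x, 0 <= f x <= 1) ->
  ((2 / 3 : R)%:E <= prod_int I0 N (fun x => (1 - f x)%:E))%E ->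
  (forall v, (2 / 3 : R)%:E <= prod_int (I v) N (fun x => (f x)%:E))%E ->
  False.
Proof.
move=> mL L0 L1 I0E IE rhoE rho0 s0 chi mf f01 Hi Hii.
have [Q QE] := exists_product_probability P N.
pose F v (x : N.-tuple T) := \prod_(i < N) L v (tnth x i).
pose E (h : N.-tuple T -> R) : \bar R := (\int[Q]_x (h x)%:E)%E.
have mprod (K : T -> R) : measurable_fun setT K -> measurable_fun [set: N.-tuple T]
    (fun x : N.-tuple T => \prod_(i < N) K (tnth x i)).
  move=> mK; apply: measurable_prod => i _.
  by apply: measurableT_comp => //; exact: measurable_tnth.
have mF v : measurable_fun setT (F v) by exact: mprod.
have F0 v x : 0 <= F v x by rewrite prodr_ge0.
have f0 x : 0 <= f x by case/andP: (f01 x).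
have f1 x : f x <= 1 by case/andP: (f01 x).
have ED (h1 h2 : N.-tuple T -> R) : measurable_fun setT h1 -> measurable_fun setT h2 ->
    (forall x, 0 <= h1 x) -> (forall x, 0 <= h2 x) ->
    E (fun x => h1 x + h2 x) = (E h1 + E h2)%E.
  move=> m1 m2 h10 h20; rewrite /E; under eq_integral do rewrite EFinD.
  by rewrite ge0_integralD//; [move=> x _; rewrite lee_fin|exact/measurable_EFinP|
    move=> x _; rewrite lee_fin|exact/measurable_EFinP].
have EZ c (h : N.-tuple T -> R) : measurable_fun setT h -> (forall x, 0 <= h x) -> 0 <= c ->
    E (fun x => c * h x) = (c%:E * E h)%E.
  move=> mh h0 c0; rewrite /E; under eq_integral do rewrite EFinM.
  by rewrite ge0_integralZl//; [exact/measurable_EFinP|move=> x _; rewrite lee_fin].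
have Ele (h1 h2 : N.-tuple T -> R) : measurable_fun setT h1 -> measurable_fun setT h2 ->
    (forall x, 0 <= h1 x) -> (forall x, h1 x <= h2 x) -> (E h1 <= E h2)%E.
  move=> m1 m2 h10 h12; apply: ge0_le_integral => //.
  - by move=> x _; rewrite lee_fin.
  - exact/measurable_EFinP.
  - exact/measurable_EFinP.
  - by move=> x _; rewrite lee_fin.
have Esum (r : seq V) (h : V -> N.-tuple T -> R) :
    (forall v, measurable_fun setT (h v)) -> (forall v x, 0 <= h v x) ->
    E (fun x => \sum_(v <- r) h v x) = (\sum_(v <- r) E (h v))%E.
  move=> mh h0; rewrite /E; under eq_integral do rewrite -sumEFin.
  by rewrite ge0_integral_sum//; [move=> v; exact/measurable_EFinP|
    move=> v x _; rewrite lee_fin].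
have Eprod (K : T -> R) r : measurable_fun setT K -> (forall x, 0 <= K x) -> 0 <= r ->
    (\int[P]_x (K x)%:E = r%:E)%E -> E (fun x => \prod_(i < N) K (tnth x i)) = (r ^+ N)%:E.
  move=> mK K0 r0 Kr; rewrite /E.
  (* The product is read as a density and not as the integrand: the integrand is then the constant
     1, whose iterated integral is a power. *)
  have -> : (r ^+ N)%:E = prod_int (fun g => \int[P]_x (g x * (K x)%:E))%E N (fun=> 1%:E).
    rewrite (@prod_int_cst _ _ _ r) ?mul1r// => c c0.
    rewrite ge0_integralZl//; [by rewrite Kr -EFinM|exact/measurable_EFinP|].
    by move=> x _; rewrite lee_fin.
  rewrite (prod_int_density mK K0 _ QE)//.
  by apply: eq_integral => x _; rewrite mul1e.
have EF v : E (F v) = 1%E by rewrite (@Eprod _ 1)// expr1n.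
have EFF v w : E (fun x => F v x * F w x) = (rho v w ^+ N)%:E.
  rewrite -(@Eprod (fun x => L v x * L w x))//; last first.
  - by move=> x; rewrite mulr_ge0.
  - exact: measurable_funM.
  by congr E; apply/funext => x; rewrite -big_split.
have EfF v : ((2 / 3)%:E <= E (fun x => f x * F v x)%R)%E.
  have := Hii v; rewrite (prod_int_density (mL v) (L0 v) (IE v) QE)//.
  exact/measurable_EFinP.
have E1f : ((2 / 3)%:E <= E (fun x => 1 - f x)%R)%E.
  move: Hi; rewrite (@prod_int_density _ _ _ P (fun=> 1) _ _ _ _ _ Q QE)//.
  - under eq_integral do rewrite big1_eq mule1; exact.
  - move=> g mg g0; rewrite I0E//; by under [RHS]eq_integral do rewrite mule1.
  - by apply/measurable_EFinP; exact: measurable_funB.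
  - by move=> x; rewrite lee_fin subr_ge0.
have mf1 : measurable_fun setT (fun x => 1 - f x) by exact: measurable_funB.
have E1 : (E (fun x => 1 - f x)%R + E f = 1)%E.
  rewrite -ED//; last by move=> x; rewrite subr_ge0.
  rewrite /E; under eq_integral do rewrite subrK.
  by rewrite integral_cst// mul1e; exact: probability_setT.
have Ef0 : (0 <= E f)%E by apply: integral_ge0 => x _; rewrite lee_fin.
have Ef : (E f <= (1 / 3)%:E)%E.
  case: (E f) Ef0 E1 => [a| |] //; last first.
    by case: (E (fun x => 1 - f x)%R) E1f.
  case: (E (fun x => 1 - f x)%R) E1f => [b| |] //.
  by rewrite !lee_fin => ? ? [] ?; lra.
pose S x := \sum_(v <- s) F v x; pose m : R := (size s)%:R.
have m0 : 0 < m by rewrite ltr0n.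
have mS : measurable_fun setT S by exact: measurable_sum.
have S0 x : 0 <= S x by rewrite sumr_ge0.
(* The pointwise inequality multiplied by [2 * m ^+ 2], with [S = m Lam]. *)
have key : (E (fun x => (2 * m) * (f x * S x) + (2 * m) * S x)%R
    <= E (fun x => S x * S x + ((3 * m ^+ 2) * f x + m ^+ 2))%R)%E.
  have mfS : measurable_fun setT (fun x => f x * S x) by exact: measurable_funM.
  apply: Ele.
  - by apply: measurable_funD; exact: measurable_funM.
  - apply: measurable_funD; first exact: measurable_funM.
    by apply: measurable_funD => //; exact: measurable_funM.
  - by move=> x; rewrite addr_ge0// !mulr_ge0// ltW.
  - move=> x; rewrite -subr_ge0.
    have -> : S x * S x + (3 * m ^+ 2 * f x + m ^+ 2) - (2 * m * (f x * S x) + 2 * m * S x)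
      = (1 - f x) * (S x - m) ^+ 2 + f x * (S x - 2 * m) ^+ 2 by ring.
    by rewrite addr_ge0// mulr_ge0 ?sqr_ge0// subr_ge0.
have ES : E S = m%:E.
  rewrite Esum// (eq_bigr (fun=> 1%E)) => [|v _]; last exact: EF.
  by rewrite sumEFin big_const_seq count_predT iter_addr_0.
have EfS : (((2 / 3) * m)%:E <= E (fun x => f x * S x)%R)%E.
  rewrite (_ : (fun x => f x * S x) = fun x => \sum_(v <- s) f x * F v x); last first.
    by apply/funext => x; rewrite big_distrr.
  rewrite Esum; last 2 first.
  - by move=> v; exact: measurable_funM.
  - by move=> v x; exact: mulr_ge0.
  apply: (@le_trans _ _ (\sum_(v <- s) (2 / 3)%:E)%E); last exact: lee_sum.
  by rewrite sumEFin big_const_seq count_predT iter_addr_0 /m mulr_natr.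
have ESS : E (fun x => S x * S x) = (\sum_(v <- s) \sum_(w <- s) rho v w ^+ N)%:E.
  rewrite (_ : (fun x => S x * S x) =
    fun x => \sum_(v <- s) \sum_(w <- s) F v x * F w x); last first.
    by apply/funext => x; rewrite big_distrlr.
  rewrite Esum; last 2 first.
  - by move=> v; apply: measurable_sum => w; exact: measurable_funM.
  - by move=> v x; apply: sumr_ge0 => w _; exact: mulr_ge0.
  rewrite -sumEFin; apply: eq_bigr => v _.
  rewrite Esum; last 2 first.
  - by move=> w; exact: measurable_funM.
  - by move=> w x; exact: mulr_ge0.
  by rewrite -sumEFin; apply: eq_bigr => w _; exact: EFF.
have mfS : measurable_fun setT (fun x => f x * S x) by exact: measurable_funM.
have fS0 x : 0 <= f x * S x by exact: mulr_ge0.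
have tm0 : 0 <= 2 * m by rewrite mulr_ge0// ltW.
have tmm0 : 0 <= 3 * m ^+ 2 by rewrite mulr_ge0// sqr_ge0.
have E1m : E (fun=> m ^+ 2) = (m ^+ 2)%:E.
  rewrite /E integral_cst// -[RHS]mule1; congr (_ * _)%E; exact: probability_setT.
move: key; rewrite ED; last 4 first.
- exact: measurable_funM.
- exact: measurable_funM.
- by move=> x; rewrite mulr_ge0.
- by move=> x; rewrite mulr_ge0.
rewrite ED; last 4 first.
- exact: measurable_funM.
- by apply: measurable_funD => //; exact: measurable_funM.
- by move=> x; rewrite mulr_ge0.
- by move=> x; rewrite addr_ge0 ?sqr_ge0 ?mulr_ge0.
rewrite (ED (fun x => 3 * m ^+ 2 * f x)); last 4 first.
- exact: measurable_funM.
- by [].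
- by move=> x; rewrite mulr_ge0.
- by move=> x; rewrite sqr_ge0.
rewrite E1m ESS !EZ// ES.
apply/negP; rewrite -ltNge.
(* Origin of the threshold [4 / 3]: the left side is at least [(4 / 3 + 2) m^2], the right side at
   most the double sum plus [2 m^2]. *)
apply: (@lt_le_trans _ _ ((2 * m) * ((2 / 3) * m) + (2 * m) * m)%:E); last first.
  by rewrite EFinD EFinM (EFinM _ m) leeD2r// lee_pmul2l ?lte_fin ?mulr_gt0.
apply: (@le_lt_trans _ _ ((\sum_(v <- s) \sum_(w <- s) rho v w ^+ N) +
   ((3 * m ^+ 2) * (1 / 3) + m ^+ 2))%:E).
  rewrite !EFinD leeD2l// leeD2r// (EFinM (3 * m ^+ 2)) lee_wpmul2l ?lee_fin//.
by rewrite lte_fin; move: chi; rewrite -/m; nra.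
Qed.

(** * Gaussian integrals *)

Lemma posdef_unitmx (R : realType) (d : nat) (S : 'M[R]_d) :
  posdef S -> S \in unitmx.
Proof.
move=> [_ Spos]; rewrite unitmxE unitfE; apply/negP => /det0P[v v0 vS].
have := Spos v^T; rewrite trmxK vS mul0mx mxE ltxx trmx_eq0 => /(_ v0).
by [].
Qed.

Lemma integral_gauss_shift (R : realType) (a m : R) : 0 < a ->
  (\int[lebesgue_measure]_x (expR (- (a * (x - m) ^+ 2) / 2))%:E
   = (Num.sqrt (pi *+ 2 / a))%:E)%E.
Proof.
move=> a0; have sa0 : 0 < Num.sqrt a by rewrite sqrtr_gt0.
pose s := (Num.sqrt a)^-1.
have s0 : s != 0 by rewrite invr_eq0 gt_eqF.
have s2 : s ^+ 2 = a^-1 by rewrite exprVn sqr_sqrtr// ltW.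
have peak : (normal_peak s)^-1 = Num.sqrt (pi *+ 2 / a).
  by rewrite /normal_peak invrK s2 -mulrnAr mulrC.
have peak0 : normal_peak s != 0 by rewrite gt_eqF// normal_peak_gt0.
transitivity (\int[lebesgue_measure]_x ((normal_peak s)^-1%:E * (normal_pdf m s x)%:E))%E.
  apply: eq_integral => x _; rewrite normal_pdfE//= -EFinM [in RHS]mulrA mulVf// mul1r.
  rewrite /normal_fun s2; congr (expR _)%:E.
  by rewrite -(mulr_natr a^-1) invfM invrK; ring.
rewrite ge0_integralZl//.
- by rewrite integral_normal_pdf mule1 peak.
- by apply/measurable_EFinP; exact: measurable_normal_pdf.
- by move=> x _; rewrite lee_fin normal_pdf_ge0.
- by rewrite lee_fin peak sqrtr_ge0.
Qed.

Lemma colv_cons (R : realType) (n : nat) (x : R) (t : n.-tuple R) :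
  colv (cons_tuple x t) = col_mx x%:M (colv t) :> 'cV_(1 + n).
Proof.
apply/colP => i; rewrite mxE; case: (split_ordP (i : 'I_(1 + n))) => j ->.
  by rewrite col_mxEu !ord1 mxE eqxx.
rewrite col_mxEd mxE (_ : rshift 1 j = lift ord0 j) ?tnthS//.
exact/val_inj.
Qed.

(* Completing the square in the first coordinate: [s] is the Schur
   complement of [K'] in [K]. *)
Lemma posdef_schur (R : realType) (n : nat) (K : 'M[R]_(1 + n)) :
  posdef K -> exists (s : R) (K' : 'M[R]_n) (u : 'cV[R]_n),
  [/\ 0 < s, posdef K', \det K = s * \det K' &
    forall (x : R) (w : 'cV[R]_n),
    ((col_mx x%:M w)^T *m K *m col_mx x%:M w) ord0 ord0 =
    s * x ^+ 2 + ((w + x *: u)^T *m K' *m (w + x *: u)) ord0 ord0].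
Proof.
move=> [Ksym Kpos].
pose k := ulsubmx K; pose b := dlsubmx K; pose K' := drsubmx K.
have KE : K = block_mx k b^T b K'.
  by rewrite -[LHS]submxK; congr block_mx; rewrite /b trmx_dlsub Ksym.
have K'sym : K'^T = K' by rewrite /K' trmx_drsub Ksym.
have K'pos : posdef K'.
  split=> // w w0; have := Kpos (col_mx 0 w).
  rewrite {1}KE tr_col_mx trmx0 mul_row_block mul_row_col !mul0mx !add0r mulmx0 add0r.
  apply; apply: contra w0 => /eqP/(congr1 dsubmx); rewrite col_mxKd => ->.
  by rewrite linear0.
have K'u := posdef_unitmx K'pos.
pose u := invmx K' *m b.
have K'uE : K' *m u = b by rewrite mulKVmx.
have uK' : u^T *m K' = b^T by rewrite -[in RHS]K'uE [RHS]trmx_mul K'sym.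
pose s := (k - b^T *m u) ord0 ord0.
have sE : k - b^T *m u = s%:M by rewrite [LHS]mx11_scalar.
have quad (x : R) (w : 'cV[R]_n) :
    ((col_mx x%:M w)^T *m K *m col_mx x%:M w) ord0 ord0 =
    s * x ^+ 2 + ((w + x *: u)^T *m K' *m (w + x *: u)) ord0 ord0.
  have kE : k = s%:M + b^T *m u by rewrite -sE subrK.
  transitivity ((x ^+ 2 *: s%:M + (w + x *: u)^T *m K' *m (w + x *: u)) ord0 ord0).
    congr (fun_of_matrix _ _ _).
    rewrite KE tr_col_mx tr_scalar_mx mul_row_block mul_row_col kE.
    have -> : (w + x *: u)^T *m K' *m (w + x *: u) =
        w^T *m K' *m w + x *: (w^T *m b) + x *: (b^T *m w) + x ^+ 2 *: (b^T *m u).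
      have -> : (w + x *: u)^T = w^T + x *: u^T by apply/matrixP => i j; rewrite !mxE.
      rewrite mulmxDl -scalemxAl uK' mulmxDl !mulmxDr.
      by rewrite -!scalemxAl -!scalemxAr -(mulmxA w^T K' u) K'uE scalerA expr2 !addrA.
    rewrite !mulmxDl !mul_mx_scalar !mul_scalar_mx -!scalemxAl !scalerDr !scalerA.
    rewrite -expr2 -!addrA; congr (_ + _).
    rewrite addrC -!addrA [RHS]addrC -!addrA.
    by congr (_ + (_ + _)); rewrite addrC.
  by rewrite !mxE eqxx mulr1n mulrC.
(* The vector [(1, - u)] annihilates the completed square, so [K] takes the value [s] there. *)
have s0 : 0 < s.
  have := quad 1 (- u); rewrite scale1r addNr mulmx0 [X in _ + X]mxE addr0 expr1n mulr1 => <-.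
  apply: Kpos; apply/negP => /eqP /(congr1 usubmx).
  rewrite col_mxKu linear0 => /(congr1 (fun M : 'M[R]_1 => M ord0 ord0)) /eqP.
  by rewrite !mxE eqxx oner_eq0.
exists s, K', u; split => //.
have : K *m block_mx 1%:M 0 (- u) 1%:M = block_mx s%:M b^T 0 K'.
  rewrite {1}KE mulmx_block !mulmx1 !mulmx0 !mulmxN K'uE subrr !add0r.
  by rewrite -sE.
move/(congr1 determinant); rewrite det_mulmx det_lblock det_ublock !det1 !mulr1.
by rewrite det_scalar1.
Qed.

Lemma posdef_det_gt0 (R : realType) (d : nat) (S : 'M[R]_d) :
  posdef S -> 0 < \det S.
Proof.
elim: d => [|n IH] in S *; first by rewrite det_mx00.
by move=> /(@posdef_schur _ n)[s [K' [u [s0 /IH K'0 -> _]]]]; rewrite mulr_gt0.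
Qed.

(** The centre [y] and the factor [c] are arbitrary for the sake of the induction: once the first
    coordinate [x] is fixed, completing the square moves the centre of the inner Gaussian by a
    multiple of [x - y0] and leaves a factor depending on [x]. *)
Lemma prod_int_gauss (R : realType) (d : nat) (K : 'M[R]_d) :
  posdef K -> forall (c : R) (y : 'cV[R]_d), 0 <= c ->
  prod_int (fun h : R -> \bar R => \int[@lebesgue_measure R]_x h x)%E d
    (fun x => (c * expR (- ((colv x - y)^T *m K *m (colv x - y)) ord0 ord0 / 2))%:E)
  = (c * Num.sqrt ((pi *+ 2) ^+ d / \det K))%:E.
Proof.
elim: d => [|n IH] in K *.
  move=> _ c y c0 /=; rewrite det_mx00 expr0 divr1 sqrtr1.
  by rewrite mxE big_ord0 oppr0 mul0r expR0.
move=> Kpos c y c0.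
have [s [K' [u [s0 K'pos detK quad]]]] := @posdef_schur _ n _ Kpos.
have K'0 := posdef_det_gt0 K'pos.
pose y0 := y ord0 ord0; pose y' : 'cV_n := dsubmx (y : 'cV_(1 + n)).
have yE : y = col_mx y0%:M y' :> 'cV_(1 + n).
  rewrite -[LHS](@vsubmxK _ 1 n); congr col_mx; rewrite [LHS]mx11_scalar mxE.
  by congr (_%:M); congr (y _ _); apply/val_inj.
pose C := c * Num.sqrt ((pi *+ 2) ^+ n / \det K').
have C0 : 0 <= C by rewrite mulr_ge0 ?sqrtr_ge0.
have subE (a b : R) (p q : 'cV[R]_n) :
    col_mx a%:M p - col_mx b%:M q = col_mx (a - b)%:M (p - q).
  by rewrite opp_col_mx add_col_mx raddfB.
transitivity (\int[lebesgue_measure]_x (C%:E * (expR (- (s * (x - y0) ^+ 2) / 2))%:E))%E.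
  apply: eq_integral => x _ /=.
  transitivity ((c * expR (- (s * (x - y0) ^+ 2) / 2) *
     Num.sqrt ((pi *+ 2) ^+ n / \det K'))%:E); last by rewrite /C -EFinM mulrAC.
  rewrite -(IH K' K'pos _ (y' - (x - y0) *: u)) ?mulr_ge0 ?expR_ge0//.
  congr prod_int; apply/funext => t; congr (_%:E); rewrite -mulrA; congr (c * _).
  rewrite -expRD -mulrDl -opprD; congr (expR (- _ / 2)).
  have -> : colv (cons_tuple x t) - y =
      col_mx (x - y0)%:M (colv t - y') :> 'cV_(1 + n).
    rewrite colv_cons yE; exact: subE.
  by rewrite quad opprB addrA addrAC.
have mexp : measurable_fun setT
    (fun x : R => (expR (- (s * (x - y0) ^+ 2) / 2))%:E).
  apply/measurable_EFinP; apply: measurableT_comp => //.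
  apply: measurable_funM => //; apply: measurableT_comp => //.
  apply: measurable_funM => //; apply: measurable_funX.
  exact: measurable_funB.
rewrite ge0_integralZl//.
rewrite integral_gauss_shift// -EFinM /C -mulrA -sqrtrM; last first.
  have pi20 : 0 <= (pi *+ 2 : R) by rewrite mulrn_wge0 ?pi_ge0.
  by apply: divr_ge0; [exact: exprn_ge0|exact: ltW].
congr (_ * Num.sqrt _)%:E; rewrite detK exprSr.
by rewrite invfM mulrACA; congr (_ * _); rewrite mulrC.
Qed.

Definition lratio (R : realType) (d : nat) (S : 'M[R]_d) (x : Rvec R d) : R :=
  gauss_density S x / gauss_density 1%:M x.

Lemma gauss_density_ge0 (R : realType) (d : nat) (S : 'M[R]_d) x :
  0 <= gauss_density S x.
Proof. by rewrite mulr_ge0 ?expR_ge0// invr_ge0 sqrtr_ge0. Qed.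

Lemma gauss_density1_gt0 (R : realType) (d : nat) (x : Rvec R d) :
  0 < gauss_density 1%:M x.
Proof.
rewrite mulr_gt0 ?expR_gt0// invr_gt0 sqrtr_gt0 det1 mulr1.
by rewrite exprn_gt0// mulrn_wgt0// pi_gt0.
Qed.

Lemma lratio_ge0 (R : realType) (d : nat) (S : 'M[R]_d) x : 0 <= lratio S x.
Proof. by rewrite divr_ge0 ?gauss_density_ge0. Qed.

Lemma quad_formE (R : realType) (d : nat) (M : 'M[R]_d) (x : Rvec R d) :
  ((colv x)^T *m M *m colv x) ord0 ord0 =
  \sum_i \sum_j tnth x j * M j i * tnth x i.
Proof.
rewrite mxE; apply: eq_bigr => i _; rewrite !mxE big_distrl/=.
by apply: eq_bigr => j _; rewrite !mxE.
Qed.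

Lemma measurable_gauss_density (R : realType) (d : nat) (S : 'M[R]_d) :
  measurable_fun [set: Rvec R d] (gauss_density S).
Proof.
apply: measurable_funM => //; apply: measurableT_comp => //.
apply: measurable_funM => //; apply: measurableT_comp => //.
under eq_fun do rewrite quad_formE.
apply: measurable_sum => i; apply: measurable_sum => j.
apply: measurable_funM; last exact: measurable_tnth.
by apply: measurable_funM => //; exact: measurable_tnth.
Qed.

Lemma measurable_lratio (R : realType) (d : nat) (S : 'M[R]_d) :
  measurable_fun [set: Rvec R d] (lratio S).
Proof.
rewrite (_ : lratio S = fun x => gauss_density S x *
  (Num.sqrt ((pi *+ 2) ^+ d) * expR (((colv x)^T *m colv x) ord0 ord0 / 2))).
  apply: measurable_funM; first exact: measurable_gauss_density.
  apply: measurable_funM => //; apply: measurableT_comp => //.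
  apply: measurable_funM => //.
  under eq_fun do rewrite -[(colv _)^T]mulmx1 quad_formE.
  apply: measurable_sum => i; apply: measurable_sum => j.
  apply: measurable_funM; last exact: measurable_tnth.
  by apply: measurable_funM => //; exact: measurable_tnth.
apply/funext => x; rewrite /lratio; congr (_ * _).
by rewrite /gauss_density det1 invmx1 mulmx1 mulr1 invfM invrK mulNr expRN invrK.
Qed.

Lemma gauss_density1E (R : realType) (d : nat) (x : Rvec R d) :
  gauss_density 1%:M x = \prod_(i < d) normal_pdf 0 1 (tnth x i).
Proof.
rewrite /gauss_density det1 invmx1 mulmx1 mulr1.
under eq_bigr do rewrite normal_pdfE ?oner_eq0//.
rewrite big_split/=; congr (_ * _).
  rewrite big_const_ord iter_mulr_1 /normal_peak expr1n mul1r exprVn; congr (_^-1).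
  elim: d {x} => [|d IH]; first by rewrite !expr0 sqrtr1.
  by rewrite !exprS sqrtrM ?IH// mulrn_wge0// pi_ge0.
rewrite mxE -sumrN big_distrl/= expR_sum; apply: eq_bigr => i _.
by rewrite /normal_fun subr0 expr1n !mxE mulNr -expr2.
Qed.

(* [lebesgue_measure] lives on [measurableTypeR R], which has the same
   measurable sets as [R] but another display: hence the pushforward by [id]. *)
Lemma exists_normal_probability (R : realType) :
  exists nR : probability R R, forall g : R -> \bar R,
    measurable_fun [set: R] g -> (forall x, 0 <= g x)%E ->
    (\int[nR]_x g x = \int[lebesgue_measure]_x (g x * (normal_pdf 0 1 x)%:E))%E.
Proof.
have [nP nPE] := exists_density_probability (P := @lebesgue_measure R)
  (measurable_normal_pdf 0 1) (normal_pdf_ge0 0 1) (integral_normal_pdf 0 1).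
pose f (x : measurableTypeR R) : R := x.
have mf : measurable_fun setT f by move=> _ A mA; rewrite setTI.
pose nu : {measure set R -> \bar R} :=
  measure_function_pushforward__canonical__measure_function_Measure nP mf.
have nuT : nu setT = 1%E by exact: (probability_setT nP).
pose mix := @Measure_isProbability.Build _ _ R nu nuT.
pose nR : probability R R := HB.pack (nu : set _ -> \bar R) nu mix.
exists nR => g mg g0; rewrite -nPE//.
rewrite [LHS](_ : _ = (\int[pushforward nP f]_x g x)%E)//.
by rewrite ge0_integral_pushforward.
Qed.

(** [P] is the product of one-dimensional normal laws; dividing by its density recovers the iterated
    Lebesgue integral. *)
Lemma exists_std_gauss (R : realType) (d : nat) :
  exists P : probability (Rvec R d) R, forall h : Rvec R d -> \bar R,
    measurable_fun [set: Rvec R d] h -> (forall x, 0 <= h x)%E ->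
    (prod_int (fun h : R -> \bar R => \int[@lebesgue_measure R]_x h x) d h =
     \int[P]_x (h x * ((gauss_density 1%:M x)^-1)%:E))%E.
Proof.
have pdf_neq0 x : normal_pdf 0 1 x != 0 :> R.
  by rewrite normal_pdfE ?oner_eq0//= mulf_neq0 ?gt_eqF ?expR_gt0// normal_peak_gt0 ?oner_eq0.
have mpdfV : measurable_fun setT (fun x : R => (normal_pdf 0 1 x)^-1).
  rewrite (_ : (fun _ => _) = fun x => (normal_peak 1)^-1 * expR (x ^+ 2 / 2)).
    apply: measurable_funM => //; apply: measurableT_comp => //.
    by apply: measurable_funM => //; exact: measurable_funX.
  apply/funext => x; rewrite normal_pdfE ?oner_eq0//= invfM /normal_fun.
  by rewrite subr0 expr1n mulNr expRN /normal_peak !invrK.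
have [nR nRE] := exists_normal_probability R.
have [P PE] := exists_product_probability nR d.
exists P => h mh h0.
rewrite (prod_int_density (P := nR) (L := fun x => (normal_pdf 0 1 x)^-1) _ _ _ PE)//.
- by apply: eq_integral => x _; rewrite gauss_density1E prodfV.
- by move=> x; rewrite invr_ge0 normal_pdf_ge0.
- move=> g mg g0; rewrite nRE.
  + apply: eq_integral => x _; rewrite -muleA -EFinM mulVf ?mule1//.
  + apply: emeasurable_funM => //; exact/measurable_EFinP.
  + by move=> x; rewrite mule_ge0// lee_fin invr_ge0 normal_pdf_ge0.
Qed.

Lemma posdef_invmx (R : realType) (d : nat) (S : 'M[R]_d) :
  posdef S -> posdef (invmx S).
Proof.
move=> Spd; have [Ssym Spos] := Spd; have Su := posdef_unitmx Spd.
split=> [|v v0]; first by rewrite trmx_inv Ssym.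
have w0 : invmx S *m v != 0.
  by apply: contra v0 => /eqP /(congr1 (mulmx S)); rewrite mulKVmx// mulmx0 => ->.
have := Spos _ w0; rewrite trmx_mul trmx_inv Ssym -!mulmxA.
by rewrite (mulmxA S) mulmxV// mul1mx mulmxA.
Qed.

Lemma gauss_int_cst1 (R : realType) (d : nat) (S : 'M[R]_d) :
  posdef S -> gauss_int S (fun=> 1%E) = 1%E.
Proof.
move=> Spd; have S0 := posdef_det_gt0 Spd.
have q0 : 0 < (pi *+ 2 : R) ^+ d by rewrite exprn_gt0// mulrn_wgt0// pi_gt0.
have := prod_int_gauss (posdef_invmx Spd) (c := (Num.sqrt ((pi *+ 2) ^+ d * \det S))^-1) 0.
rewrite invr_ge0 sqrtr_ge0 det_inv invrK mulVf; last first.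
  by rewrite gt_eqF// sqrtr_gt0 mulr_gt0.
move=> H; rewrite -[RHS]H//; congr prod_int; apply/funext => x.
by rewrite mul1e subr0.
Qed.

(** Both sides equal [S + S' - S S']. This is how the precision matrix of a product of two
    likelihood ratios becomes the determinant in the correlation. *)
Lemma mul_invmx_addB (R : realType) (d : nat) (S S' : 'M[R]_d) :
  S \in unitmx -> S' \in unitmx ->
  S *m (invmx S + invmx S' - 1%:M) *m S' =
  1%:M - (S - 1%:M) *m (S' - 1%:M).
Proof.
move=> Su S'u; rewrite mulmxBr mulmxDr mulmxV// mulmx1 mulmxBl mulmxDl mul1mx.
rewrite -(mulmxA S) mulVmx// mulmx1 [in RHS]mulmxBl !(mulmxBr _ S') mul1mx !mulmx1.
by rewrite opprB addrA (addrC 1%:M) subrK opprB addrA.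
Qed.

(** The integrand is a centred Gaussian density of [S] times that of [S'] over the standard one, so
    its exponent has precision [invmx S + invmx S' - 1%:M]; positivity of this matrix is what makes
    the integral finite. *)
Lemma gauss_int_lratio (R : realType) (d : nat) (S S' : 'M[R]_d) :
  posdef S -> posdef S' -> posdef (invmx S + invmx S' - 1%:M) ->
  gauss_int S (fun x => (lratio S' x)%:E) =
  ((Num.sqrt (\det (1%:M - (S - 1%:M) *m (S' - 1%:M))))^-1)%:E.
Proof.
move=> Spd S'pd Kpd; set K := invmx S + _ - _ in Kpd.
have S0 := posdef_det_gt0 Spd; have S'0 := posdef_det_gt0 S'pd.
have K0 := posdef_det_gt0 Kpd.
rewrite -mul_invmx_addB ?posdef_unitmx// !det_mulmx -/K.
pose q : R := (pi *+ 2) ^+ d.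
have q0 : 0 < q by rewrite exprn_gt0// mulrn_wgt0// pi_gt0.
pose c := (Num.sqrt (q * \det S))^-1 * (Num.sqrt (q * \det S'))^-1 * Num.sqrt q.
have c0 : 0 <= c by rewrite !mulr_ge0 ?invr_ge0 ?sqrtr_ge0.
transitivity (c * Num.sqrt (q / \det K))%:E; last first.
  rewrite /c !sqrtrM ?ltW ?mulr_gt0// sqrtrV ?ltW// !invfM; congr _%:E.
  field.
  by rewrite !gt_eqF ?sqrtr_gt0.
rewrite -(prod_int_gauss Kpd 0 c0); congr prod_int; apply/funext => x.
rewrite -EFinM subr0; congr _%:E; rewrite /lratio /gauss_density.
rewrite det1 invmx1 mulr1 mulmx1 -/q !invfM invrK -expRN.
have entryE (M1 M2 M3 : 'M[R]_1) : (M1 + M2 - M3) ord0 ord0 =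
  M1 ord0 ord0 + M2 ord0 ord0 - M3 ord0 ord0 by rewrite !mxE.
rewrite /c /K mulmxBr mulmxDr mulmx1 mulmxBl mulmxDl entryE.
set Q1 := (_ *m invmx S *m _) _ _; set Q2 := (_ *m invmx S' *m _) _ _.
set Q3 := (_ *m colv x) _ _.
have -> : - (Q1 + Q2 - Q3) / 2 = - Q2 / 2 + (- (- Q3 / 2) + - Q1 / 2) by ring.
rewrite !expRD; ring.
Qed.

(** [P] is chosen before [S], so that all the alternatives have densities against one law, as the
    second moment method requires. *)
Lemma exists_gauss_lratio (R : realType) (d : nat) :
  exists P : probability (Rvec R d) R, forall (S : 'M[R]_d) (g : Rvec R d -> \bar R),
    measurable_fun [set: Rvec R d] g -> (forall x, 0 <= g x)%E ->
    gauss_int S g = (\int[P]_x (g x * (lratio S x)%:E))%E.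
Proof.
have [P PE] := exists_std_gauss R d; exists P => S g mg g0.
rewrite /gauss_int PE.
- by apply: eq_integral => x _; rewrite -muleA -EFinM.
- apply: emeasurable_funM => //; apply/measurable_EFinP.
  exact: measurable_gauss_density.
- by move=> x; rewrite mule_ge0// lee_fin gauss_density_ge0.
Qed.

(** * Expansion of the log-determinant *)

(** The exponent is the series of [- ln (1 - u)] with quartic coefficient 1 in place of [1 / 4].
    With this slack the derivative of the right side is a positive multiple of [u ^+ 3], so the
    minimum on the interval is at 0. *)
Lemma one_le_subMexpR (R : realType) (u : R) : `|u| <= 1 / 2 ->
  1 <= (1 - u) * expR (u + u ^+ 2 / 2 + u ^+ 3 / 3 + u ^+ 4).
Proof.
pose w (x : R) : R := x + (x ^+ 2 / 2 + (x ^+ 3 / 3 + x ^+ 4)).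
pose h (x : R) : R := (1 - x) * expR (w x).
pose dh (x : R) : R := expR (w x) * (x ^+ 3 * (3 - 4 * x)).
have wD (x : R) : is_derive x (1 : R) w (1 + (x + (x ^+ 2 + 4 * x ^+ 3))).
  apply: is_derive_eq => /=; rewrite /GRing.scale/=.
  by field.
have hD (x : R) : is_derive x (1 : R) h (dh x).
  apply: is_derive_eq => /=; rewrite /GRing.scale/=.
  by rewrite /dh; ring.
have h0 : h 0 = 1 by rewrite /h /w !expr0n/= !mul0r !addr0 expR0 subr0 mul1r.
have hc (A : set R) : {within A, continuous h}.
  apply: continuous_subspaceT => x; apply: differentiable_continuous.
  by apply/derivable1_diffP; have [] := hD x.
have hder (x : R) : derive1 h x = dh x by rewrite derive1E; have [] := hD x.
rewrite ler_norml => /andP[u1 u2]; rewrite -[leLHS]h0.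
rewrite (_ : u + _ + _ + _ = w u); last by rewrite /w !addrA.
rewrite -/(h u); have [u0|/ltW u0] := leP 0 u.
  apply: (@ger0_derive1_le_cc _ h 0 (1/2)) => //.
  - move=> x; rewrite in_itv/= => /andP[x0 x1]; rewrite hder.
    by rewrite mulr_ge0 ?expR_ge0// mulr_ge0 ?exprn_ge0 ?(ltW x0)//; lra.
  - by rewrite in_itv/= lexx/=; lra.
  - by rewrite in_itv/= u0.
apply: (@ler0_derive1_le_cc _ h (- (1/2)) 0) => //.
- move=> x; rewrite in_itv/= => /andP[x0 x1]; rewrite hder.
  by rewrite mulr_ge0_le0 ?expR_ge0//; nra.
- by rewrite in_itv/= lexx; lra.
- by rewrite in_itv/= u0 andbT.
Qed.

(** For [z = a + i b] the exponent is twice the real part of [z + z^2 / 2 + z^3 / 3], plus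
    [25 |z|^4]. Since [|1 - z|^2 = 1 - u] with the real number [u = 2 a - |z|^2], the real
    inequality suffices and no complex logarithm is needed. *)
Lemma one_le_sqr_norm_expR (R : realType) (a b : R) :
  a ^+ 2 + b ^+ 2 <= 1 / 25 ->
  1 <= ((1 - a) ^+ 2 + b ^+ 2) *
    expR (2 * a + (a ^+ 2 - b ^+ 2) + 2 / 3 * (a ^+ 3 - 3 * a * b ^+ 2)
          + 25 * (a ^+ 2 + b ^+ 2) ^+ 2).
Proof.
set r := a ^+ 2 + b ^+ 2 => r25.
have b0 : 0 <= b ^+ 2 by exact: sqr_ge0.
have r0 : 0 <= r by rewrite addr_ge0 ?sqr_ge0.
have a2 : a ^+ 2 <= r by rewrite lerDl.
have [a5 a5'] : - (1 / 5) <= a /\ a <= 1 / 5 by split; nra.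
pose u := 2 * a - r.
have uE : (1 - a) ^+ 2 + b ^+ 2 = 1 - u by rewrite /u /r; ring.
have u12 : `|u| <= 1 / 2 by rewrite ler_norml /u; apply/andP; split; lra.
rewrite uE; apply: (le_trans (one_le_subMexpR u12)).
have u1 : 0 <= 1 - u by move: u12; rewrite ler_norml => /andP[]; lra.
rewrite ler_wpM2l// ler_expR.
have bE : b ^+ 2 = r - a ^+ 2 by rewrite /r; ring.
have u2 : u ^+ 2 <= 121 / 25 * r.
  have -> : u ^+ 2 = 4 * a ^+ 2 - 4 * a * r + r ^+ 2 by rewrite /u; ring.
  have : - a * r <= 1 / 5 * r by rewrite ler_wpM2r//; lra.
  have : r ^+ 2 <= 1 / 25 * r by rewrite expr2 ler_wpM2r.
  nra.
have u4 : u ^+ 4 <= (121 / 25 * r) ^+ 2.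
  by rewrite (exprM u 2 2) lerXn2r// nnegrE ?sqr_ge0// mulr_ge0.
have r2 : 0 <= r ^+ 2 by exact: sqr_ge0.
have ar : a * r ^+ 2 <= 1 / 5 * r ^+ 2 by rewrite ler_wpM2r.
have aar : 0 <= a ^+ 2 * r by rewrite mulr_ge0// sqr_ge0.
have r3 : 0 <= r ^+ 3 by rewrite exprn_ge0.
have -> : u + u ^+ 2 / 2 + u ^+ 3 / 3 + u ^+ 4 =
  2 * a + (a ^+ 2 - b ^+ 2) + 2 / 3 * (a ^+ 3 - 3 * a * b ^+ 2)
  + (r ^+ 2 / 2 - 4 * (a ^+ 2 * r) + 2 * (a * r ^+ 2) - r ^+ 3 / 3 + u ^+ 4).
  by rewrite bE /u; field.
rewrite lerD2l; nra.
Qed.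

Section complex_modulus.
Variable R : realType.
Local Open Scope complex_scope.
Implicit Types z w : R[i].

Definition modulus2 z : R := complex.Re z ^+ 2 + complex.Im z ^+ 2.

Lemma modulus2M z w : modulus2 (z * w) = modulus2 z * modulus2 w.
Proof. by case: z => a b; case: w => c d; rewrite /modulus2 /=; ring. Qed.

Lemma modulus2_ge0 z : 0 <= modulus2 z.
Proof. by rewrite addr_ge0 ?sqr_ge0. Qed.

Lemma modulus2_prod (I : Type) (s : seq I) (F : I -> R[i]) :
  modulus2 (\prod_(i <- s) F i) = \prod_(i <- s) modulus2 (F i).
Proof.
elim/big_rec2 : _ => [|i y z _ <-]; last by rewrite modulus2M.
by rewrite /modulus2 /= expr1n expr0n addr0.
Qed.

Lemma one_le_modulus2_expR z : modulus2 z <= 1 / 25 ->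
  1 <= modulus2 (1 - z) *
    expR (complex.Re (z *+ 2 + z ^+ 2 + (2 / 3)%:C * z ^+ 3) + 25 * modulus2 z ^+ 2).
Proof.
case: z => a b h; have := one_le_sqr_norm_expR h; rewrite /modulus2.
have -> : (1 - (a +i* b) : R[i]) = (1 - a) +i* (- b) by simpc.
rewrite /= sqrrN => /le_trans; apply; rewrite ler_wpM2l ?addr_ge0 ?sqr_ge0//.
rewrite ler_expR lerD2r mulr2n !exprS expr0; simpc => /=.
rewrite le_eqVlt; apply/orP; left; apply/eqP; by field.
Qed.

End complex_modulus.

Lemma trig_mulmx (F : pzRingType) (n : nat) (A B : 'M[F]_n) :
  is_trig_mx A -> is_trig_mx B ->
  is_trig_mx (A *m B) /\ forall i, (A *m B) i i = A i i * B i i.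
Proof.
move=> /is_trig_mxP At /is_trig_mxP Bt; split.
  apply/is_trig_mxP => i j ij; rewrite mxE big1// => k _.
  have [ik|ki] := ltnP i k; first by rewrite At ?mul0r.
  by rewrite Bt ?mulr0// (leq_ltn_trans ki).
move=> i; rewrite mxE (bigD1 i)//= big1 ?addr0// => k /negPf ki.
have [ik|ki'] := ltnP i k; first by rewrite At ?mul0r.
by rewrite Bt ?mulr0// ltn_neqAle val_eqE ki ki'.
Qed.

Section schur_spectrum.
Variable R : realType.
Local Open Scope complex_scope.

(* [lam] is the diagonal of a Schur triangularization of [Y]. *)
Lemma exists_schur_spectrum (n : nat) (Y : 'M[R]_n) : (0 < n)%N ->
  exists lam : 'I_n -> R[i],
  [/\ (\det (1%:M - Y))%:C = \prod_i (1 - lam i),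
      (\tr Y)%:C = \sum_i lam i,
      (\tr (Y *m Y))%:C = \sum_i lam i ^+ 2,
      (\tr (Y *m Y *m Y))%:C = \sum_i lam i ^+ 3 &
      \sum_i modulus2 (lam i) <= \sum_i \sum_j Y i j ^+ 2].
Proof.
(* [Y] will be a multiple of a product of two symmetric matrices, which need not have a real
   spectrum. *)
move=> n0; pose Yc : 'M[R[i]]_n := map_mx (real_complex R) Y.
have [P Pu] := Schur Yc n0.
rewrite /similar_to conjymx//; set Q := (P ^t*)%sesqui.
have PQ : P *m Q = 1%:M by apply/unitarymxP.
have QP : Q *m P = 1%:M by exact: mulmx1C.
set T := P *m Yc *m Q => Tt.
have tr_conj (M : 'M[R[i]]_n) : \tr (P *m M *m Q) = \tr M.
  by rewrite mxtrace_mulC mulmxA QP mul1mx.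
have T2 : T *m T = P *m (Yc *m Yc) *m Q.
  by rewrite /T !mulmxA -(mulmxA _ Q P) QP mulmx1.
have T3 : T *m T *m T = P *m (Yc *m Yc *m Yc) *m Q.
  by rewrite T2 /T !mulmxA -(mulmxA _ Q P) QP mulmx1.
have [TTt TTd] := trig_mulmx Tt Tt.
have [_ TTTd] := trig_mulmx TTt Tt.
exists (fun i => T i i); split.
- rewrite -det_map_mx map_mxB map_mx1.
  have -> : \det (1%:M - Yc) = \det (P *m (1%:M - Yc) *m Q).
    by rewrite !det_mulmx mulrC mulrA -det_mulmx QP det1 mul1r.
  rewrite mulmxBr mulmxBl mulmx1 PQ -/T det_trig.
    by apply: eq_bigr => i _; rewrite !mxE eqxx.
  apply/is_trig_mxP => i j ij; rewrite mxE [X in _ + X]mxE (is_trig_mxP Tt)//.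
  by rewrite oppr0 addr0 mxE -val_eqE ltn_eqF.
- by rewrite -trace_map_mx -tr_conj.
- rewrite -trace_map_mx map_mxM -tr_conj -T2.
  by apply: eq_bigr => i _; rewrite TTd expr2.
- rewrite -trace_map_mx !map_mxM -tr_conj -T3.
  by apply: eq_bigr => i _; rewrite TTTd TTd exprSr.
(* Schur's inequality: the Frobenius norm is unitarily invariant, and the diagonal of [T]
   contributes only part of it. *)
rewrite -lecR (_ : (\sum_i \sum_j Y i j ^+ 2)%:C =
    \sum_i \sum_j (modulus2 (T i j))%:C); last first.
  transitivity (\tr (Yc *m (Yc ^t*)%sesqui)).
    rewrite rmorph_sum; apply: eq_bigr => i _; rewrite mxE rmorph_sum.
    apply: eq_bigr => j _; rewrite !mxE rmorphXn /= expr2; congr (_ * _).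
    by rewrite conj_Creal//; apply/complex_realP; exists (Y i j).
  rewrite -tr_conj; transitivity (\tr (T *m (T ^t*)%sesqui)).
    have -> : (T ^t*)%sesqui = P *m ((Yc ^t*)%sesqui *m Q).
      by rewrite /T !trmx_mul !map_mxM -[in RHS](trmxCK P).
    by rewrite /T !mulmxA -(mulmxA _ Q P) QP mulmx1.
  apply: eq_bigr => i _; rewrite mxE; apply: eq_bigr => j _.
  by rewrite !mxE -normCK add_Re2_Im2.
rewrite rmorph_sum; apply: ler_sum => i _.
rewrite (bigD1 i)//= lerDl sumr_ge0// => j _.
by rewrite ler0c modulus2_ge0.
Qed.

End schur_spectrum.

(* Summing the scalar inequality over the complex eigenvalues; the squared
   moduli of the eigenvalues add up to at most the squared Frobenius norm. *)
Lemma one_le_det_expR (R : realType) (n : nat) (Y : 'M[R]_n) (phi : R) :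
  (0 < n)%N -> \sum_i \sum_j Y i j ^+ 2 <= phi -> phi <= 1 / 25 ->
  1 <= (\det (1%:M - Y)) ^+ 2 *
    expR (2 * \tr Y + \tr (Y *m Y) + 2 / 3 * \tr (Y *m Y *m Y) + 25 * phi ^+ 2).
Proof.
move=> n0 Yphi phi25.
have [lam [detE tr1E tr2E tr3E]] := exists_schur_spectrum Y n0.
move=> /le_trans/(_ Yphi) lam_phi.
have m0 i : 0 <= modulus2 (lam i) by exact: modulus2_ge0.
have lam_le i : modulus2 (lam i) <= phi.
  by apply: le_trans lam_phi; rewrite (bigD1 i)//= lerDl sumr_ge0.
have phi0 : 0 <= phi by apply: le_trans lam_phi; exact: sumr_ge0.
pose q z : R := complex.Re (z *+ 2 + z ^+ 2 + (real_complex R (2 / 3)) * z ^+ 3).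
have -> : (\det (1%:M - Y)) ^+ 2 = \prod_i modulus2 (1 - lam i).
  by rewrite -modulus2_prod -detE /modulus2/= expr0n addr0.
have qE : \sum_i q (lam i) =
    2 * \tr Y + \tr (Y *m Y) + 2 / 3 * \tr (Y *m Y *m Y).
  rewrite /q -(raddf_sum (@complex.Re R)) !big_split/= -big_distrr/= -tr2E -tr3E.
  by rewrite -tr1E /=; ring.
apply: (@le_trans _ _ ((\prod_i modulus2 (1 - lam i)) *
   expR (\sum_i (q (lam i) + 25 * modulus2 (lam i) ^+ 2)))); last first.
  rewrite ler_wpM2l ?prodr_ge0// => [i _|]; first exact: modulus2_ge0.
  rewrite ler_expR big_split/= qE lerD2l -big_distrr/= ler_wpM2l//.
  rewrite expr2; apply: le_trans (_ : phi * \sum_i modulus2 (lam i) <= _).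
    by rewrite big_distrr/= ler_sum// => i _; rewrite expr2 ler_wpM2r.
  by rewrite ler_wpM2l.
rewrite expR_sum -big_split/=; elim/big_rec : _ => // i x _ x1.
rewrite -[leLHS]mulr1; apply: ler_pM => //.
exact/one_le_modulus2_expR/(le_trans (lam_le i)).
Qed.

(** * Quadratic bounds for the exponential and the correlation of two Gaussians *)

Lemma expR_le_quad_half (R : realType) (y : R) : `|y| <= 1 / 2 ->
  expR y <= 1 + y + 2 * y ^+ 2.
Proof.
rewrite ler_norml => /andP[y1 y2].
have y0 : 0 < 1 - y by lra.
have ey : (1 - y) * expR y <= 1.
  by rewrite -ler_pdivlMr ?expR_gt0// div1r -expRN expR_ge1Dx.
(* [(1 - y) (1 + y + 2 y^2) = 1 + y^2 (1 - 2 y)], which is at least 1 here. *)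
rewrite -(ler_pM2l y0); apply: (le_trans ey); nra.
Qed.

Lemma expR_le_quad (R : realType) (b y : R) : `|y| <= b ->
  expR y <= 1 + y + (4 * expR b + 4 * b + 2) * y ^+ 2.
Proof.
move=> yb; have b0 : 0 <= b by apply: le_trans yb.
have y20 : 0 <= y ^+ 2 by exact: sqr_ge0.
have eb0 : 0 <= expR b by exact: expR_ge0.
have [y12|y12] := leP `|y| (1 / 2).
  apply: (le_trans (expR_le_quad_half y12)); nra.
have y2 : 1 <= 4 * y ^+ 2 by rewrite -real_normK ?num_real//; nra.
move: yb; rewrite ler_norml => /andP[by1 by2].
have : expR y <= expR b by rewrite ler_expR.
nra.
Qed.

(** The sharp constant is [1 / 2]; the crude 2 has a short proof and costs only constants. *)
Lemma cosh_le_expR (R : realType) (x : R) :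
  (expR x + expR (- x)) / 2 <= expR (2 * x ^+ 2).
Proof.
have [x12|x12] := leP `|x| (1 / 2).
  apply: (le_trans _ (expR_ge1Dx _)).
  have := expR_le_quad_half x12.
  have := @expR_le_quad_half _ (- x); rewrite normrN sqrrN => /(_ x12).
  lra.
have x2 : `|x| <= 2 * x ^+ 2 by rewrite -(real_normK (num_real x)); nra.
have xl : x <= `|x| by exact: ler_norm.
have xr : - x <= `|x| by rewrite -normrN ler_norm.
have : expR x <= expR (2 * x ^+ 2) by rewrite ler_expR; lra.
have : expR (- x) <= expR (2 * x ^+ 2) by rewrite ler_expR; lra.
lra.
Qed.

(** [D] stands for [det (I - t M)], the [t_i] for the traces of the powers of [M], and [psi] for a
    bound on its squared Frobenius norm. The first three orders are kept exact, because only signed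
    terms can cancel in the mixture; their squares are absorbed by [t1 ^+ 2 + psi ^+ 2]. The
    constant depends on [tau] alone, hence not on the dimension. *)
Lemma exists_overlap_const (R : realType) (tau : R) : 1 <= tau ->
  exists C : R, 0 <= C /\ forall D t t1 t2 t3 psi : R,
  0 < D -> 1 <= D ^+ 2 *
    expR (2 * (t * t1) + t ^+ 2 * t2 + 2 / 3 * (t ^+ 3 * t3) + 25 * (t ^+ 2 * psi) ^+ 2) ->
  `|t| <= tau -> `|t1| <= 1 -> `|t2| <= psi -> t3 ^+ 2 <= psi ^+ 3 ->
  tau ^+ 2 * psi <= 1 / 25 ->
  (Num.sqrt D)^-1 <=
    1 + t * t1 / 2 + t ^+ 2 * t2 / 4 + t ^+ 3 * t3 / 6 + C * (t1 ^+ 2 + psi ^+ 2).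
Proof.
move=> tau1; pose K := 4 * expR (2 * tau) + 4 * (2 * tau) + 2.
have K0 : 0 <= K by rewrite /K !addr_ge0 ?mulr_ge0 ?expR_ge0//; lra.
exists (25 / 4 * tau ^+ 4 + K * tau ^+ 4); split.
  by rewrite addr_ge0// ?mulr_ge0 ?exprn_ge0//; lra.
move=> D t t1 t2 t3 psi D0 hD ht ht1 ht2 ht3 hpsi.
have psi0 : 0 <= psi by exact: le_trans ht2.
pose y := t * t1 / 2 + t ^+ 2 * t2 / 4 + t ^+ 3 * t3 / 6 + 25 / 4 * (t ^+ 2 * psi) ^+ 2.
have Dy : (Num.sqrt D)^-1 <= expR y.
  have sD : 0 < Num.sqrt D by rewrite sqrtr_gt0.
  (* The hypothesis is a lower bound for [D^2 exp (4 y)], so a fourth root is taken. *)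
  have : 1 <= (Num.sqrt D * expR y) ^+ 4.
    apply: le_trans hD _; rewrite [leRHS]exprMn (exprM (Num.sqrt D) 2 2) (sqr_sqrtr (ltW D0)).
    rewrite ler_wpM2l ?sqr_ge0// -expRM_natl ler_expR /y.
    rewrite le_eqVlt; apply/orP; left; apply/eqP; by field.
  have e0 : 0 <= Num.sqrt D * expR y by rewrite mulr_ge0 ?expR_ge0// sqrtr_ge0.
  rewrite (expr_ge1 (n := 4) isT e0) => h1.
  by rewrite -[leLHS]mulr1 ler_pdivrMl.
have t0 : 0 <= `|t| by [].
pose a := tau ^+ 2 * psi.
have a0 : 0 <= a by rewrite mulr_ge0// sqr_ge0.
have tt : t ^+ 2 <= tau ^+ 2 by rewrite -(real_normK (num_real t)) lerXn2r// nnegrE//; lra.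
have tt0 : 0 <= t ^+ 2 by exact: sqr_ge0.
have y1 : (t * t1) ^+ 2 <= tau ^+ 2 * t1 ^+ 2.
  by rewrite exprMn ler_wpM2r ?sqr_ge0.
have y2 : (t ^+ 2 * t2) ^+ 2 <= a ^+ 2.
  rewrite -(real_normK (num_real (_ * t2))) lerXn2r ?nnegrE// normrM.
  by rewrite ger0_norm// ler_pM.
have y3 : (t ^+ 3 * t3) ^+ 2 <= a ^+ 3.
  have -> : (t ^+ 3 * t3) ^+ 2 = (t ^+ 2) ^+ 3 * t3 ^+ 2 by ring.
  have -> : a ^+ 3 = (tau ^+ 2) ^+ 3 * psi ^+ 3 by rewrite /a; ring.
  apply: ler_pM => //; [exact: exprn_ge0|exact: sqr_ge0|].
  by rewrite lerXn2r ?nnegrE ?sqr_ge0.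
have y4 : t ^+ 2 * psi <= a by rewrite ler_wpM2r.
have y40 : 0 <= t ^+ 2 * psi by rewrite mulr_ge0.
pose z1 := t * t1; pose z2 := t ^+ 2 * t2; pose z3 := t ^+ 3 * t3; pose z4 := t ^+ 2 * psi.
have t11 : t1 ^+ 2 <= 1 by rewrite -(real_normK (num_real t1)) exprn_ile1.
have a2 : a ^+ 2 = tau ^+ 4 * psi ^+ 2 by rewrite /a; ring.
have tau4 : tau ^+ 2 <= tau ^+ 4 by rewrite ler_weXn2l.
have sum4 (p q r v : R) : (p + q + r + v) ^+ 2 <= 4 * (p ^+ 2 + q ^+ 2 + r ^+ 2 + v ^+ 2).
  have := sqr_ge0 (p - q); have := sqr_ge0 (p - r); have := sqr_ge0 (p - v).
  have := sqr_ge0 (q - r); have := sqr_ge0 (q - v); have := sqr_ge0 (r - v).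
  nra.
have a25 : a ^+ 3 <= 1 / 25 * a ^+ 2 by rewrite exprS ler_wpM2r ?sqr_ge0.
have z42 : z4 ^+ 2 <= a ^+ 2 by rewrite lerXn2r ?nnegrE.
have z44 : (z4 ^+ 2) ^+ 2 <= 1 / 625 * a ^+ 2.
  apply: (@le_trans _ _ ((a ^+ 2) ^+ 2)); first by rewrite lerXn2r ?nnegrE ?sqr_ge0.
  rewrite [leLHS]expr2 ler_wpM2r ?sqr_ge0//.
  have -> : 1 / 625 = (1 / 25) ^+ 2 :> R by field.
  by rewrite lerXn2r ?nnegrE//; lra.
have ysqa : y ^+ 2 <= tau ^+ 2 * t1 ^+ 2 + a ^+ 2.
  apply: (le_trans (sum4 (z1 / 2) (z2 / 4) (z3 / 6) (25 / 4 * z4 ^+ 2))).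
  have -> : 4 * ((z1 / 2) ^+ 2 + (z2 / 4) ^+ 2 + (z3 / 6) ^+ 2 + (25 / 4 * z4 ^+ 2) ^+ 2)
    = z1 ^+ 2 + z2 ^+ 2 / 4 + z3 ^+ 2 / 9 + 625 / 4 * (z4 ^+ 2) ^+ 2 by field.
  rewrite -/z1 in y1; rewrite -/z2 in y2; rewrite -/z3 in y3.
  by have := sqr_ge0 a; lra.
have ysq : y ^+ 2 <= tau ^+ 4 * (t1 ^+ 2 + psi ^+ 2).
  apply: (le_trans ysqa); rewrite a2 mulrDr lerD2r ler_wpM2r ?sqr_ge0//.
have tau0 : 0 <= tau by lra.
have yb : `|y| <= 2 * tau.
  rewrite -(@ler_pXn2r _ 2) ?nnegrE ?mulr_ge0// real_normK ?num_real//.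
  apply: (le_trans ysqa).
  have : a ^+ 2 <= 1 by rewrite exprn_ile1// (le_trans hpsi)//; lra.
  have : 1 <= tau ^+ 2 by rewrite exprn_ege1.
  nra.
apply: (le_trans Dy); apply: (le_trans (expR_le_quad yb)); rewrite -/K.
have -> : 1 + t * t1 / 2 + t ^+ 2 * t2 / 4 + t ^+ 3 * t3 / 6 +
  (25 / 4 * tau ^+ 4 + K * tau ^+ 4) * (t1 ^+ 2 + psi ^+ 2) =
  1 + y + K * (tau ^+ 4 * (t1 ^+ 2 + psi ^+ 2)) +
  (25 / 4 * (tau ^+ 4 * (t1 ^+ 2 + psi ^+ 2)) - 25 / 4 * (t ^+ 2 * psi) ^+ 2).
  by rewrite /y; field.
have : K * y ^+ 2 <= K * (tau ^+ 4 * (t1 ^+ 2 + psi ^+ 2)) by rewrite ler_wpM2l.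
have : z4 ^+ 2 <= tau ^+ 4 * (t1 ^+ 2 + psi ^+ 2).
  by apply: (le_trans z42); rewrite a2 mulrDr lerDr mulr_ge0 ?sqr_ge0// exprn_ge0.
rewrite -/z4; lra.
Qed.

(** * Frobenius norm and correlation of likelihood ratios *)

Lemma cauchy_schwarz_sum (R : realType) (I : finType) (x y : I -> R) :
  (\sum_i x i * y i) ^+ 2 <= (\sum_i x i ^+ 2) * (\sum_i y i ^+ 2).
Proof.
set X := \sum_i x i ^+ 2; set Y := \sum_i y i ^+ 2; set Z := \sum_i x i * y i.
have X0 : 0 <= X by apply: sumr_ge0 => i _; exact: sqr_ge0.
have quad (c : R) : 0 <= X * c ^+ 2 - 2 * c * Z + Y.
  have -> : X * c ^+ 2 - 2 * c * Z + Y = \sum_i (c * x i - y i) ^+ 2.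
    rewrite /X /Y /Z big_distrl big_distrr/= -sumrN -!big_split/=.
    by apply: eq_bigr => i _; ring.
  by apply: sumr_ge0 => i _; exact: sqr_ge0.
have [X00|Xn0] := eqVneq X 0.
  have x0 i : x i = 0.
    move: X00 => /eqP; rewrite psumr_eq0 => [/allP/(_ i (mem_index_enum _))|j _].
      by rewrite sqrf_eq0 => /eqP.
    exact: sqr_ge0.
  by rewrite /Z big1 => [|i _]; rewrite ?x0 ?mul0r// X00 mul0r expr0n.
have Xp : 0 < X by rewrite lt_neqAle eq_sym Xn0.
have := quad (Z / X); rewrite -(ler_pM2l Xp) mulr0.
have -> : X * (X * (Z / X) ^+ 2 - 2 * (Z / X) * Z + Y) = X * Y - Z ^+ 2.
  by field.
by rewrite subr_ge0.
Qed.

Definition frob2 (R : realType) (m n : nat) (A : 'M[R]_(m, n)) : R :=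
  \sum_i \sum_j A i j ^+ 2.

Section frob2_theory.
Variable R : realType.

Lemma frob2_ge0 m n (A : 'M[R]_(m, n)) : 0 <= frob2 A.
Proof. by apply: sumr_ge0 => i _; apply: sumr_ge0 => j _; exact: sqr_ge0. Qed.

Lemma frob2_eq0 m n (A : 'M[R]_(m, n)) : frob2 A = 0 -> A = 0.
Proof.
move=> /eqP; rewrite psumr_eq0 => [/allP A0|i _]; last first.
  by apply: sumr_ge0 => j _; exact: sqr_ge0.
apply/matrixP => i j; rewrite mxE.
move: (A0 i (mem_index_enum _)); rewrite /= psumr_eq0 => [/allP/(_ j (mem_index_enum _))|k _].
  by rewrite sqrf_eq0 => /eqP.
exact: sqr_ge0.
Qed.

Lemma frob2_gt0 m n (A : 'M[R]_(m, n)) : A != 0 -> 0 < frob2 A.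
Proof.
by move=> A0; rewrite lt_neqAle frob2_ge0 andbT eq_sym; apply: contra A0 => /eqP/frob2_eq0 ->.
Qed.

Lemma frob2E m n (A : 'M[R]_(m, n)) : frob2 A = \tr (A *m A^T).
Proof.
apply: eq_bigr => i _; rewrite mxE; apply: eq_bigr => j _.
by rewrite mxE expr2.
Qed.

Lemma frob2_trmx m n (A : 'M[R]_(m, n)) : frob2 A^T = frob2 A.
Proof. by rewrite !frob2E trmxK mxtrace_mulC. Qed.

Lemma frob2Z m n (a : R) (A : 'M[R]_(m, n)) : frob2 (a *: A) = a ^+ 2 * frob2 A.
Proof.
rewrite /frob2 big_distrr/=; apply: eq_bigr => i _.
by rewrite big_distrr/=; apply: eq_bigr => j _; rewrite mxE exprMn.
Qed.

Lemma mxtrace_mul_le m n (A : 'M[R]_(m, n)) (B : 'M[R]_(n, m)) :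
  (\tr (A *m B)) ^+ 2 <= frob2 A * frob2 B.
Proof.
rewrite -(frob2_trmx B) /frob2 /mxtrace !pair_big/=.
have -> : \sum_i (A *m B) i i = \sum_(p : 'I_m * 'I_n) A p.1 p.2 * B^T p.1 p.2.
  rewrite -(pair_bigA _ (fun i j => A i j * B^T i j))/=.
  by apply: eq_bigr => i _; rewrite mxE; apply: eq_bigr => j _; rewrite mxE.
exact: cauchy_schwarz_sum.
Qed.

Lemma frob2M m n p (A : 'M[R]_(m, n)) (B : 'M[R]_(n, p)) :
  frob2 (A *m B) <= frob2 A * frob2 B.
Proof.
rewrite -(frob2_trmx B) /frob2 big_distrlr/= ; apply: ler_sum => i _.
apply: ler_sum => k _; rewrite mxE.
rewrite (eq_bigr (fun j => A i j * B^T k j)) => [|j _]; last by rewrite mxE.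
exact: cauchy_schwarz_sum.
Qed.

End frob2_theory.

Lemma frob_sqrt (R : realType) (m n : nat) (A : 'M[R]_(m, n)) :
  frob A = Num.sqrt (frob2 A).
Proof. by []. Qed.

(** For symmetric [A], [|A v|^2] is the inner product of [A^2 v] with [v], and Cauchy-Schwarz
    applies. This bounds the operator norm by the fourth root of [frob2 (A *m A)] without
    diagonalizing; [frob2 A = 1] alone would give no smallness. *)
Lemma frob2_sym_contract (R : realType) (d : nat) (A : 'M[R]_d) (v : 'cV[R]_d) :
  A^T = A -> frob2 (A *m v) ^+ 2 <= frob2 (A *m A) * frob2 v ^+ 2.
Proof.
move=> Asym.
have -> : frob2 (A *m v) = \tr ((A *m A *m v) *m v^T).
  by rewrite frob2E trmx_mul Asym mxtrace_mulC !mulmxA [RHS]mxtrace_mulC !mulmxA.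
apply: (le_trans (mxtrace_mul_le _ _)); rewrite frob2_trmx expr2 mulrA.
by rewrite ler_wpM2r ?frob2_ge0// frob2M.
Qed.

(** * Positive definiteness near the identity *)

Section perturbation_of_identity.
Variables (R : realType) (d : nat).
Implicit Types B : 'M[R]_d.

(** Operator norm at most [1 / 2], stated without spectral theory. *)
Let contr B := B^T = B /\ forall w : 'cV[R]_d, frob2 (B *m w) <= frob2 w / 4.

Lemma cV_frob2E (w : 'cV[R]_d) : (w^T *m w) ord0 ord0 = frob2 w.
Proof.
rewrite -frob2_trmx frob2E trmxK /mxtrace big_ord1.
by congr (_ _ _); apply/val_inj.
Qed.

(** The cross terms cancel in [w^T (I + B) w - |(I + B) w|^2 / 2 = (|w|^2 - |B w|^2) / 2]. The bound
    serves both for [I + B] and, after substituting [v = (I + B) w], for its inverse. *)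
Lemma perturb_quad_ge B (w : 'cV[R]_d) : contr B ->
  frob2 ((1%:M + B) *m w) / 2 + frob2 w * (3 / 8) <=
  (w^T *m (1%:M + B) *m w) ord0 ord0.
Proof.
move=> [Bsym Bc]; have := Bc w.
have -> : frob2 ((1%:M + B) *m w) =
    frob2 w + 2 * (w^T *m B *m w) ord0 ord0 + frob2 (B *m w).
  rewrite mulmxDl mul1mx -mulmxA; set u := B *m w.
  have uw : (u^T *m w) ord0 ord0 = (w^T *m u) ord0 ord0.
    by rewrite -[u^T *m w]trmxK trmx_mul trmxK mxE.
  rewrite -[frob2 (w + u)]cV_frob2E [(w + u)^T]raddfD /= mulmxDl !mulmxDr.
  have entryE (M1 M2 M3 M4 : 'M[R]_1) : (M1 + M2 + (M3 + M4)) ord0 ord0 =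
    M1 ord0 ord0 + M2 ord0 ord0 + (M3 ord0 ord0 + M4 ord0 ord0) by rewrite !mxE.
  by rewrite entryE uw !cV_frob2E; ring.
have -> : (w^T *m (1%:M + B) *m w) ord0 ord0 = frob2 w + (w^T *m B *m w) ord0 ord0.
  by rewrite mulmxDr mulmx1 mulmxDl mxE cV_frob2E.
lra.
Qed.

Lemma perturb_posdef B : contr B -> posdef (1%:M + B).
Proof.
move=> Bc; split; first by rewrite raddfD /= trmx1 Bc.1.
move=> v v0; apply: lt_le_trans (perturb_quad_ge v Bc).
have := frob2_gt0 v0; have := frob2_ge0 ((1%:M + B) *m v); lra.
Qed.

(** Each inverse strictly exceeds [I / 2], so their sum exceeds the identity. *)
Lemma perturb_inv_posdef B B' : contr B -> contr B' ->
  posdef (invmx (1%:M + B) + invmx (1%:M + B') - 1%:M).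
Proof.
move=> Bc B'c.
have key B0 (v : 'cV[R]_d) : contr B0 -> v != 0 ->
    frob2 v / 2 < (v^T *m invmx (1%:M + B0) *m v) ord0 ord0.
  move=> B0c v0; have Spd := perturb_posdef B0c; have Su := posdef_unitmx Spd.
  set S := 1%:M + B0 in Spd Su *; pose w := invmx S *m v.
  have vE : v = S *m w by rewrite mulKVmx.
  have w0 : w != 0 by apply: contra v0; rewrite vE => /eqP ->; rewrite mulmx0.
  have -> : (v^T *m invmx S *m v) ord0 ord0 = (w^T *m S *m w) ord0 ord0.
    by rewrite -mulmxA -/w {1}vE trmx_mul Spd.1.
  apply: lt_le_trans (perturb_quad_ge w B0c); rewrite -/S -vE.
  by have := frob2_gt0 w0; lra.
split.
  rewrite !(raddfD, raddfN) /= trmx1 !trmx_inv.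
  by rewrite (perturb_posdef Bc).1 (perturb_posdef B'c).1.
move=> v v0; rewrite mulmxBr mulmxDr mulmx1 mulmxBl mulmxDl.
have entryE (M1 M2 M3 : 'M[R]_1) : (M1 + M2 - M3) ord0 ord0 =
  M1 ord0 ord0 + M2 ord0 ord0 - M3 ord0 ord0 by rewrite !mxE.
rewrite entryE cV_frob2E.
by have := key B v Bc v0; have := key B' v B'c v0; lra.
Qed.

Lemma contractZ (s : R) B (psi : R) : B^T = B -> frob2 (B *m B) <= psi ->
  s ^+ 4 * psi <= 1 / 16 -> contr (s *: B).
Proof.
move=> Bsym Bpsi spsi; split; first by rewrite linearZ /= Bsym.
move=> w; have w0 := frob2_ge0 w.
rewrite -(@ler_pXn2r _ 2) ?nnegrE ?frob2_ge0 ?divr_ge0//.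
rewrite -scalemxAl frob2Z exprMn -exprM.
apply: (@le_trans _ _ (s ^+ 4 * (psi * frob2 w ^+ 2))).
  rewrite ler_wpM2l ?exprn_even_ge0//.
  apply: (le_trans (frob2_sym_contract _ Bsym)).
  by rewrite ler_wpM2r ?sqr_ge0.
by rewrite mulrA exprMn mulrC ler_wpM2l ?sqr_ge0//; lra.
Qed.

End perturbation_of_identity.

Section overlap.
Variable R : realType.

(** [frob2 (A *m B)] is the trace of [A^2 B^2]. Submultiplicativity would only give 1 for normalized
    [A] and [B]; this gives order [1 / d]. *)
Lemma frob2_mul_sym (d : nat) (A B : 'M[R]_d) (psi : R) :
  A^T = A -> B^T = B -> frob2 (A *m A) <= psi -> frob2 (B *m B) <= psi ->
  frob2 (A *m B) <= psi.
Proof.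
move=> Asym Bsym Apsi Bpsi; have psi0 : 0 <= psi by apply: le_trans Apsi; exact: frob2_ge0.
have -> : frob2 (A *m B) = \tr ((A *m A) *m (B *m B)).
  by rewrite frob2E trmx_mul Asym Bsym !mulmxA mxtrace_mulC !mulmxA.
rewrite (le_trans (ler_norm _))// -(@ler_pXn2r _ 2) ?nnegrE// real_normK ?num_real//.
by apply: (le_trans (mxtrace_mul_le _ _)); rewrite expr2 ler_pM ?frob2_ge0.
Qed.

(** The single bound on [Lam ^+ 4 * psi] does two jobs: it makes [s A] and [t B] contractions, and
    it makes [s t A B] small enough for the determinant expansion. *)
Lemma exists_lratio_overlap_const (Lam : R) : 1 <= Lam ->
  exists C : R, 0 <= C /\ forall (d : nat) (A B : 'M[R]_d) (psi s t : R),
  (0 < d)%N -> A^T = A -> B^T = B -> frob2 A = 1 -> frob2 B = 1 ->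
  frob2 (A *m A) <= psi -> frob2 (B *m B) <= psi -> Lam ^+ 4 * psi <= 1 / 25 ->
  `|s| <= Lam -> `|t| <= Lam ->
  let M := A *m B in let S := 1%:M + s *: A in let S' := 1%:M + t *: B in
  [/\ posdef S, posdef S', posdef (invmx S + invmx S' - 1%:M) &
  (Num.sqrt (\det (1%:M - (S - 1%:M) *m (S' - 1%:M))))^-1 <=
    1 + (s * t) * \tr M / 2 + (s * t) ^+ 2 * \tr (M *m M) / 4
      + (s * t) ^+ 3 * \tr (M *m M *m M) / 6 + C * (\tr M ^+ 2 + psi ^+ 2)].
Proof.
move=> Lam1; have Lam21 : 1 <= Lam ^+ 2 by rewrite exprn_ege1.
have [C [C0 CP]] := exists_overlap_const Lam21; exists C; split=> //.
move=> d A B psi s t d0 Asym Bsym A1 B1 Apsi Bpsi Lampsi sLam tLam M S S'.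
have psi0 : 0 <= psi by apply: le_trans Apsi; exact: frob2_ge0.
have Lam0 : 0 <= Lam by lra.
have pow4 (r : R) : `|r| <= Lam -> r ^+ 4 * psi <= 1 / 16.
  move=> rLam; apply: (@le_trans _ _ (Lam ^+ 4 * psi)); last by lra.
  rewrite ler_wpM2r// (exprM _ 2 2) (exprM Lam 2 2) lerXn2r ?nnegrE ?sqr_ge0//.
  by rewrite -(real_normK (num_real r)) lerXn2r.
have Sc := contractZ Asym Apsi (pow4 _ sLam).
have S'c := contractZ Bsym Bpsi (pow4 _ tLam).
have Spd : posdef S by exact: perturb_posdef.
have S'pd : posdef S' by exact: perturb_posdef.
have Kpd : posdef (invmx S + invmx S' - 1%:M) by exact: perturb_inv_posdef.
split=> //.
have stE : (S - 1%:M) *m (S' - 1%:M) = (s * t) *: M.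
  rewrite /S /S' ![1%:M + _]addrC !addrK -scalemxAl -scalemxAr scalerA //.
have D0 : 0 < \det (1%:M - (s * t) *: M).
  rewrite -stE -mul_invmx_addB ?posdef_unitmx// !det_mulmx.
  by rewrite !mulr_gt0// posdef_det_gt0.
have Mpsi : frob2 M <= psi by exact: frob2_mul_sym.
have stLam : `|s * t| <= Lam ^+ 2 by rewrite normrM expr2 ler_pM.
have st2 : (s * t) ^+ 2 <= Lam ^+ 4.
  rewrite -(real_normK (num_real _)) (exprM Lam 2 2) lerXn2r ?nnegrE ?sqr_ge0//.
have M2psi : frob2 (M *m M) <= psi ^+ 2.
  by apply: (le_trans (frob2M _ _)); rewrite expr2 ler_pM ?frob2_ge0.
rewrite stE; apply: CP => //.
- have -> : 2 * (s * t * \tr M) + (s * t) ^+ 2 * \tr (M *m M) +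
      2 / 3 * ((s * t) ^+ 3 * \tr (M *m M *m M)) =
    2 * \tr ((s * t) *: M) + \tr (((s * t) *: M) *m ((s * t) *: M)) +
      2 / 3 * \tr (((s * t) *: M) *m ((s * t) *: M) *m ((s * t) *: M)).
    by rewrite -!scalemxAl -!scalemxAr !scalerA -scalemxAl !mxtraceZ; ring.
  apply: one_le_det_expR => //.
    by rewrite -/(frob2 _) frob2Z ler_wpM2l ?sqr_ge0.
  by apply: le_trans Lampsi; rewrite ler_wpM2r.
- rewrite -(@ler_pXn2r _ 2) ?nnegrE// real_normK ?num_real// expr1n.
  by apply: (le_trans (mxtrace_mul_le _ _)); rewrite A1 B1 mulr1.
- rewrite -(@ler_pXn2r _ 2) ?nnegrE// real_normK ?num_real//.
  by apply: (le_trans (mxtrace_mul_le _ _)); rewrite expr2 ler_pM ?frob2_ge0.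
- apply: (le_trans (mxtrace_mul_le _ _)); rewrite exprSr.
  by rewrite ler_pM ?frob2_ge0.
- by rewrite -exprM.
Qed.

(* The vanishing third moment removes the trace of [(A B) ^+ 3], for which the
   bound [psi ^ (3/2)] would be too weak. *)
Lemma mixture_overlap_le (K : finType) (w s : K -> R) (C t1 t2 t3 psi : R)
    (rho : K -> K -> R) :
  0 <= C -> (forall k, 0 <= w k) -> \sum_k w k = 1 -> \sum_k w k * s k = 0 ->
  \sum_k w k * s k ^+ 3 = 0 ->
  (forall k l, rho k l <= 1 + (s k * s l) * t1 / 2 + (s k * s l) ^+ 2 * t2 / 4
      + (s k * s l) ^+ 3 * t3 / 6 + C * (t1 ^+ 2 + psi ^+ 2)) ->
  \sum_k \sum_l w k * w l * rho k l <=
  1 + (\sum_k w k * s k ^+ 2) ^+ 2 / 4 * t2 + C * (t1 ^+ 2 + psi ^+ 2).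
Proof.
move=> C0 w0 w1 ws1 ws3 rho_le.
set W2 := \sum_k w k * s k ^+ 2; set E := C * _.
have dd (x : K -> R) : \sum_k \sum_l (w k * x k) * (w l * x l) = (\sum_k w k * x k) ^+ 2.
  by rewrite expr2 big_distrlr.
apply: (@le_trans _ _ (\sum_k \sum_l ((w k * 1) * (w l * 1) * (1 + E) +
   (w k * s k) * (w l * s l) * (t1 / 2) +
   (w k * s k ^+ 2) * (w l * s l ^+ 2) * (t2 / 4) +
   (w k * s k ^+ 3) * (w l * s l ^+ 3) * (t3 / 6)))).
  apply: ler_sum => k _; apply: ler_sum => l _.
  apply: (@le_trans _ _ (w k * w l * (1 + (s k * s l) * t1 / 2 +
      (s k * s l) ^+ 2 * t2 / 4 + (s k * s l) ^+ 3 * t3 / 6 + E))).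
    by rewrite ler_wpM2l ?mulr_ge0.
  by rewrite le_eqVlt; apply/orP; left; apply/eqP; field.
have dz (x : K -> R) c : \sum_k \sum_l (w k * x k) * (w l * x l) * c =
    (\sum_k w k * x k) ^+ 2 * c.
  by rewrite -dd big_distrl; apply: eq_bigr => k _; rewrite big_distrl.
under eq_bigr do rewrite !big_split/=.
rewrite !big_split/= (dz (fun=> 1)) (dz s) (dz (fun k => s k ^+ 2)) (dz (fun k => s k ^+ 3)).
rewrite ws1 ws3 -/W2 !expr0n/= !mul0r !addr0.
have -> : \sum_k w k * 1 = 1 by rewrite -[RHS]w1; apply: eq_bigr => k _; rewrite mulr1.
lra.
Qed.

End overlap.

(** * Exponential moments of Rademacher chaos *)

Section rademacher_chaos.
Variables (R : realType) (I : finType).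
Implicit Types (v : {ffun I -> bool}) (Q : I -> I -> R) (s : seq I).

Definition sgb (b : bool) : R := (-1) ^+ b.

Lemma sgb_sqr b : sgb b * sgb b = 1.
Proof. by rewrite /sgb -expr2 sqrr_sign. Qed.

Lemma sgbN b : sgb (~~ b) = - sgb b.
Proof. by rewrite /sgb; case: b; rewrite ?expr0 ?expr1 ?opprK. Qed.

Lemma normr_sgb b : `|sgb b| = 1.
Proof. by rewrite /sgb normr_sign. Qed.

Definition flip (a : I) v : {ffun I -> bool} :=
  [ffun i => if i == a then ~~ v i else v i].

Lemma flipK a : involutive (flip a).
Proof. by move=> v; apply/ffunP => i; rewrite !ffunE; case: eqP => // _; rewrite negbK. Qed.

Lemma sum_flip a (F : {ffun I -> bool} -> R) :
  \sum_v F (flip a v) = \sum_v F v.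
Proof. by rewrite [RHS](reindex_inj (inv_inj (flipK a))). Qed.

(** Averaging over one independent sign, done by an involution instead of a product
    decomposition. *)
Lemma sum_flip_avg a (F : {ffun I -> bool} -> R) :
  \sum_v F v = \sum_v (F v + F (flip a v)) / 2.
Proof. by rewrite -mulr_suml big_split/= (sum_flip a F); field. Qed.

(** Each unordered pair of positions once, without the diagonal, and with the row of the head split
    off: a chaos then loses one sign per induction step. *)
Fixpoint opairs s : seq (I * I) :=
  if s is a :: s' then [seq (a, b) | b <- s'] ++ opairs s' else [::].

Lemma sum_opairs_cons a s (F : I * I -> R) :
  \sum_(p <- opairs (a :: s)) F p =
  \sum_(b <- s) F (a, b) + \sum_(p <- opairs s) F p.
Proof. by rewrite big_cat big_map. Qed.

Lemma opairs_mem s p : p \in opairs s -> p.1 \in s /\ p.2 \in s.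
Proof.
elim: s => [|a s IH] //=; rewrite mem_cat => /orP[/mapP[b bs ->]|/IH[p1 p2]] /=.
  by rewrite !inE eqxx bs orbT.
by rewrite !inE p1 p2 !orbT.
Qed.

Lemma sqr_sum_opairs s (f : I -> R) :
  (\sum_(b <- s) f b) ^+ 2 =
  \sum_(b <- s) f b ^+ 2 + 2 * \sum_(p <- opairs s) f p.1 * f p.2.
Proof.
elim: s => [|a s IH]; first by rewrite !big_nil expr0n mulr0 addr0.
rewrite sum_opairs_cons /= !big_cons sqrrD IH -big_distrr/=; ring.
Qed.

Lemma cauchy_schwarz_seq (J : eqType) (r : seq J) (x y : J -> R) :
  (\sum_(i <- r) x i * y i) ^+ 2 <=
  (\sum_(i <- r) x i ^+ 2) * (\sum_(i <- r) y i ^+ 2).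
Proof.
rewrite [X in X ^+ 2]big_tnth [X in _ <= X * _]big_tnth [X in _ <= _ * X]big_tnth.
exact: cauchy_schwarz_sum.
Qed.

Let chaos Q s v := \sum_(p <- opairs s) Q p.1 p.2 * (sgb (v p.1) * sgb (v p.2)).
Let mass Q s := \sum_(p <- opairs s) Q p.1 p.2 ^+ 2.

(* Averaging over the first sign replaces it by [cosh], which is at most a
   Gaussian: the quadratic form on the remaining signs is perturbed by the
   rank-one form [4 q q^T], [q] being the first row, and its mass bound drops
   from [phi] to [phi - 2 |q|^2], which pays for the constant [2 |q|^2]. *)
Lemma chaos_exp_moment s Q (phi : R) :
  uniq s -> 0 <= phi <= 1 / 16 -> mass Q s <= phi ^+ 2 ->
  \sum_v expR (chaos Q s v) <= #|{ffun I -> bool}|%:R * expR phi.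
Proof.
elim: s Q phi => [|a s IH] Q phi.
  move=> _ /andP[phi0 _] _; rewrite (eq_bigr (fun=> 1)) => [|v _].
    by rewrite sumr_const ler_peMr// (le_trans _ (expR_ge1Dx _))// lerDl.
  by rewrite /chaos big_nil expR0.
move=> /= /andP[as_ us] /andP[phi0 phi1]; rewrite /mass sum_opairs_cons /=.
set q := Q a; set beta := \sum_(b <- s) q b ^+ 2 => hmass.
have beta0 : 0 <= beta by apply: sumr_ge0 => b _; exact: sqr_ge0.
have mass0 : 0 <= mass Q s by apply: sumr_ge0 => b _; exact: sqr_ge0.
have massQ : mass Q s <= phi ^+ 2 - beta by rewrite -/(mass Q s) in hmass; lra.
pose Q' b c := Q b c + 4 * (q b * q c).
pose X v := \sum_(b <- s) q b * sgb (v b).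
have flipE v b : b \in s -> flip a v b = v b.
  by move=> bs; rewrite ffunE; case: eqP => // ba; rewrite -ba bs in as_.
have Xflip v : X (flip a v) = X v.
  by apply: eq_big_seq => b bs; rewrite flipE.
have Tflip v : chaos Q s (flip a v) = chaos Q s v.
  by apply: eq_big_seq => p /opairs_mem[p1 p2]; rewrite !flipE.
have split_chaos v : chaos Q (a :: s) v = sgb (v a) * X v + chaos Q s v.
  rewrite /chaos sum_opairs_cons /X big_distrr; congr (_ + _).
  by apply: eq_bigr => b _ /=; rewrite /q; ring.
have X2 v : 2 * X v ^+ 2 + chaos Q s v = 2 * beta + chaos Q' s v.
  rewrite sqr_sum_opairs /chaos /Q'.
  have -> : \sum_(b <- s) (q b * sgb (v b)) ^+ 2 = beta.
    by apply: eq_bigr => b _; rewrite exprMn [sgb _ ^+ 2]expr2 sgb_sqr mulr1.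
  rewrite mulrDr -addrA; congr (_ + _); rewrite mulrA big_distrr/= -big_split/=.
  by apply: eq_bigr => p _; ring.
have step v : (expR (chaos Q (a :: s) v) + expR (chaos Q (a :: s) (flip a v))) / 2
    <= expR (2 * beta) * expR (chaos Q' s v).
  rewrite !split_chaos Xflip Tflip ffunE eqxx sgbN -expRD -X2 mulNr.
  set x := sgb (v a) * X v.
  have -> : X v ^+ 2 = x ^+ 2 by rewrite exprMn [sgb _ ^+ 2]expr2 sgb_sqr mul1r.
  rewrite !expRD -mulrDl mulrAC ler_wpM2r ?expR_ge0// cosh_le_expR//.
have beta_phi : beta <= phi ^+ 2 by lra.
have phi2 : phi ^+ 2 <= 1 / 16 * phi by rewrite expr2 ler_wpM2r.
have massqq : \sum_(p <- opairs s) (q p.1 * q p.2) ^+ 2 <= beta ^+ 2 / 2.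
  rewrite sqr_sum_opairs.
  have : 0 <= \sum_(b <- s) (q b ^+ 2) ^+ 2 by apply: sumr_ge0 => b _; exact: sqr_ge0.
  rewrite (eq_bigr (fun p => q p.1 ^+ 2 * q p.2 ^+ 2)) => [|p _]; last by rewrite exprMn.
  lra.
have cross : \sum_(p <- opairs s) Q p.1 p.2 * (q p.1 * q p.2) <= phi * beta.
  rewrite (le_trans (ler_norm _))// -(@ler_pXn2r _ 2) ?nnegrE ?mulr_ge0//.
  rewrite real_normK ?num_real//; apply: (le_trans (cauchy_schwarz_seq _ _ _)).
  rewrite exprMn; apply: ler_pM => //.
  - by apply: sumr_ge0 => b _; exact: sqr_ge0.
  - by move: massQ; rewrite /mass; lra.
  - by have := sqr_ge0 beta; lra.
(* After expansion it remains to see [12 phi beta + 4 beta^2 <= beta], which holds as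
   [phi <= 1 / 16] and [beta <= 1 / 256]. *)
have massQ' : mass Q' s <= (phi - 2 * beta) ^+ 2.
  have -> : mass Q' s = mass Q s + (8 * \sum_(p <- opairs s) Q p.1 p.2 * (q p.1 * q p.2)
      + 16 * \sum_(p <- opairs s) (q p.1 * q p.2) ^+ 2).
    rewrite /mass /Q' !big_distrr/= -!big_split/=.
    by apply: eq_bigr => p _; ring.
  have h1 : phi * beta <= 1 / 16 * beta by rewrite ler_wpM2r.
  have h2 : beta ^+ 2 <= 1 / 256 * beta by rewrite expr2 ler_wpM2r//; nra.
  nra.
rewrite (sum_flip_avg a); apply: (@le_trans _ _
   (\sum_v expR (2 * beta) * expR (chaos Q' s v))).
  by apply: ler_sum => v _; exact: step.
rewrite -big_distrr/=.
have := IH Q' (phi - 2 * beta) us _ massQ'.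
have -> : 0 <= phi - 2 * beta <= 1 / 16 by apply/andP; split; lra.
move=> /(_ isT) h; apply: (@le_trans _ _ (expR (2 * beta) *
  (#|{ffun I -> bool}|%:R * expR (phi - 2 * beta)))).
  by rewrite ler_wpM2l ?expR_ge0.
by rewrite mulrCA -expRD (addrC _ (phi - _)) subrK.
Qed.

Lemma size_opairs s : (size (opairs s) <= size s ^ 2)%N.
Proof.
elim: s => [|a s IH] //=; rewrite size_cat size_map.
apply: (leq_trans (leq_add (leqnn _) IH)).
by rewrite -[leqRHS]/(_.+1 * _.+1)%N mulSn mulnS addSnnS leq_add2l expnS expn1 -addSn leq_addl.
Qed.

Lemma sum_sum_opairs s (F : I -> I -> R) :
  \sum_(a <- s) \sum_(b <- s) F a b =
  \sum_(a <- s) F a a + \sum_(p <- opairs s) (F p.1 p.2 + F p.2 p.1).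
Proof.
elim: s => [|a s IH]; first by rewrite !big_nil addr0.
rewrite sum_opairs_cons /= !big_cons.
have -> : \sum_(i <- s) \sum_(b <- a :: s) F i b =
    \sum_(i <- s) F i a + \sum_(i <- s) \sum_(b <- s) F i b.
  by rewrite -big_split; apply: eq_bigr => i _; rewrite big_cons.
by rewrite IH [in RHS]big_split/=; ring.
Qed.

(** Symmetry of a matrix makes two entries share a sign; [p] sends an entry to its sign. Summing
    over fibres multiplies coefficients by at most 4 and symmetrizing by 2 more, whence the chaos
    bound with [phi = 8 K |I|]; the diagonal is a constant of size at most [4 K |I|]. *)
Lemma folded_chaos_exp_moment (J : finType) (p : J -> I) (c : J -> J -> R) (K : R) :
  (forall a, #|[pred x | p x == a]| <= 2)%N ->
  (forall x y, `|c x y| <= K) -> 0 <= K -> 8 * K * #|I|%:R <= 1 / 16 ->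
  \sum_(v : {ffun I -> bool})
    expR (\sum_x \sum_y c x y * (sgb (v (p x)) * sgb (v (p y)))) <=
  #|{ffun I -> bool}|%:R * expR 1.
Proof.
move=> fib cK K0 KI.
pose Q a b := \sum_(x | p x == a) \sum_(y | p y == b) c x y.
have sum_fib a (t : R) : 0 <= t -> \sum_(x | p x == a) t <= 2 * t.
  move=> t0; rewrite (eq_bigl (fun x => x \in [pred x | p x == a]))//.
  by rewrite sumr_const -[leLHS]mulr_natl ler_wpM2r// ler_nat; exact: fib.
have QK a b : `|Q a b| <= 4 * K.
  apply: (le_trans (ler_norm_sum _ _ _)).
  apply: (@le_trans _ _ (\sum_(x | p x == a) (2 * K))); last first.
    by apply: (le_trans (sum_fib _ _ _)); rewrite ?mulr_ge0//; lra.
  apply: ler_sum => x _; apply: (le_trans (ler_norm_sum _ _ _)).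
  by apply: le_trans (sum_fib b K K0); apply: ler_sum => y _.
pose n : R := #|I|%:R.
have n0 : 0 <= n by rewrite ler0n.
have sizeI : size (index_enum I) = #|I| by rewrite cardT enumT.
pose Q' a b := Q a b + Q b a.
have formE v : \sum_x \sum_y c x y * (sgb (v (p x)) * sgb (v (p y))) =
    \sum_a Q a a + chaos Q' (index_enum I) v.
  transitivity (\sum_a \sum_b Q a b * (sgb (v a) * sgb (v b))).
    rewrite (partition_big p xpredT)//=; apply: eq_bigr => a _.
    rewrite exchange_big/= (partition_big p xpredT)//=; apply: eq_bigr => b _.
    rewrite exchange_big/= /Q big_distrl/=; apply: eq_bigr => x /eqP <-.
    by rewrite big_distrl/=; apply: eq_bigr => y /eqP <-.
  rewrite sum_sum_opairs; congr (_ + _).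
    by apply: eq_bigr => a _; rewrite sgb_sqr mulr1.
  by apply: eq_bigr => q _; rewrite /Q'; ring.
have diag : \sum_a Q a a <= 4 * K * n.
  apply: (@le_trans _ _ (\sum_(a : I) (4 * K))).
    by apply: ler_sum => a _; exact: le_trans (ler_norm _) (QK _ _).
  by rewrite sumr_const -[leLHS]mulr_natr.
have massQ' : mass Q' (index_enum I) <= (8 * K * n) ^+ 2.
  apply: (@le_trans _ _ (\sum_(q <- opairs (index_enum I)) (8 * K) ^+ 2)).
    apply: ler_sum => q _; rewrite -(real_normK (num_real (Q' _ _))).
    rewrite lerXn2r ?nnegrE ?mulr_ge0//.
    by apply: (le_trans (ler_normD _ _)); have := QK q.1 q.2; have := QK q.2 q.1; lra.
  rewrite big_const_seq count_predT iter_addr_0 -[leLHS]mulr_natr [leRHS]exprMn.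
  rewrite ler_wpM2l ?sqr_ge0// -natrX ler_nat -sizeI; exact: size_opairs.
under eq_bigr do rewrite formE expRD.
rewrite -big_distrr/=; apply: (@le_trans _ _ (expR (4 * K * n) *
    (#|{ffun I -> bool}|%:R * expR (8 * K * n)))).
  apply: ler_pM; rewrite ?expR_ge0 ?ler_expR//.
    by apply: sumr_ge0 => v _; exact: expR_ge0.
  apply: chaos_exp_moment => //; first exact: index_enum_uniq.
  by rewrite KI andbT !mulr_ge0.
by rewrite mulrCA -expRD ler_wpM2l// ler_expR; rewrite -/n in KI; lra.
Qed.

End rademacher_chaos.

(** * The random sign matrix *)

Section sign_prior.
Variables (R : realType) (d : nat).
Local Notation I := ('I_d * 'I_d)%type.
Local Notation signs := {ffun I -> bool}.
Implicit Types v : signs.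

Definition ordered_pair (x : I) : I := if (x.1 <= x.2)%N then x else (x.2, x.1).

(** A sign is drawn for every pair, but only those on or above the diagonal enter; the index type
    stays a plain product. *)
Definition sign_mx v : 'M[R]_d :=
  \matrix_(i, j) (sgb R (v (ordered_pair (i, j))) / d%:R).

Lemma ordered_pairC i j : ordered_pair (i, j) = ordered_pair (j, i).
Proof.
rewrite /ordered_pair /=; by case: ltngtP => // /val_inj ->.
Qed.

Lemma ordered_pair_inv x y : ordered_pair x = ordered_pair y ->
  x = y \/ x = (y.2, y.1).
Proof.
case: x => i j; case: y => k l; rewrite /ordered_pair /=.
by case: ifP => _; case: ifP => _ [-> ->]; [left|right|right|left].
Qed.

Lemma ordered_pair_fibre a : (#|[pred x | ordered_pair x == a]| <= 2)%N.
Proof.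
have [[x xa]|nx] := pselect (exists x, ordered_pair x = a); last first.
  by rewrite eq_card0// => x; rewrite inE; apply/negP => /eqP xa; apply: nx; exists x.
apply: (@leq_trans #|pred2 x (x.2, x.1)|); last by rewrite card2; case: eqP.
apply: subset_leq_card; apply/fintype.subsetP => y; rewrite !inE => /eqP.
by rewrite -xa => /ordered_pair_inv[->|->]; rewrite eqxx ?orbT.
Qed.

Lemma sign_mx_sym v : (sign_mx v)^T = sign_mx v.
Proof. by apply/matrixP => i j; rewrite !mxE ordered_pairC. Qed.

Hypothesis d0 : (0 < d)%N.

Let dR0 : d%:R != 0 :> R. Proof. by rewrite pnatr_eq0 -lt0n. Qed.

Lemma sign_mx_sqr v i j : sign_mx v i j ^+ 2 = d%:R ^- 2.
Proof. by rewrite mxE exprMn expr2 sgb_sqr mul1r exprVn. Qed.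

Lemma normr_sign_mx v i j : `|sign_mx v i j| = d%:R^-1.
Proof. by rewrite mxE normrM normr_sgb mul1r ger0_norm// invr_ge0. Qed.

Lemma frob2_sign_mx v : frob2 (sign_mx v) = 1.
Proof.
rewrite /frob2; under eq_bigr do under eq_bigr do rewrite sign_mx_sqr.
rewrite !sumr_const card_ord -[LHS]mulr_natr -[X in X * _]mulr_natr; field.
by [].
Qed.

(** A sign that occurs once averages to zero. The edge [{i, j}] is repeated only if [l = i] and
    [k = j], and then the loop [{i, i}] occurs once. *)
Lemma sum_sign4 i j k l : i != k -> j != l ->
  \sum_(v : signs) sgb R (v (ordered_pair (i, j))) * sgb R (v (ordered_pair (j, k))) *
    (sgb R (v (ordered_pair (i, l))) * sgb R (v (ordered_pair (l, k)))) = 0.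
Proof.
move=> ik jl.
have odd_flip (a b c e : I) : ordered_pair b != ordered_pair a ->
    ordered_pair c != ordered_pair a -> ordered_pair e != ordered_pair a ->
    \sum_(v : signs) sgb R (v (ordered_pair a)) * (sgb R (v (ordered_pair b)) *
     (sgb R (v (ordered_pair c)) * sgb R (v (ordered_pair e)))) = 0.
  move=> ba ca ea; rewrite (sum_flip_avg (ordered_pair a)) big1// => v _.
  rewrite !ffunE eqxx (negPf ba) (negPf ca) (negPf ea) sgbN; ring.
have neq (x y : I) : x != y -> x != (y.2, y.1) -> ordered_pair x != ordered_pair y.
  by move=> xy xy'; apply/negP => /eqP/ordered_pair_inv[]/eqP; apply/negP.
have [/andP[/eqP il /eqP jk]|ilk] := boolP ((i == l) && (j == k)).
  subst l k; rewrite -[RHS](odd_flip (i, i) (i, j) (j, j) (i, j)).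
  - by apply: eq_bigr => v _; ring.
  - by apply: neq; rewrite xpair_eqE eqxx/= eq_sym.
  - by apply: neq; rewrite xpair_eqE/= negb_and eq_sym ik.
  - by apply: neq; rewrite xpair_eqE eqxx/= eq_sym.
rewrite -[RHS](odd_flip (i, j) (j, k) (i, l) (l, k)).
- by apply: eq_bigr => v _; ring.
- apply: neq; rewrite xpair_eqE/= negb_and.
    by have [->|//] := eqVneq j i; rewrite eq_sym ik.
  by rewrite (eq_sym k) ik orbT.
- apply: neq; rewrite xpair_eqE/= negb_and; first by rewrite (eq_sym l) jl orbT.
  by have [->|//] := eqVneq i j; rewrite eq_sym jl.
- apply: neq; rewrite xpair_eqE/= negb_and.
    by move: ilk; rewrite negb_and (eq_sym l) (eq_sym k).
  by rewrite (eq_sym k) ik orbT.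
Qed.

(** Only the quadruples with [i = k] or [j = l] contribute, at most [2 d^3] of them, each of weight
    [d^(-4)]. *)
Lemma sum_frob2_sqr_sign_mx :
  \sum_(v : signs) frob2 (sign_mx v *m sign_mx v) <= #|{: signs}|%:R * (2 / d%:R).
Proof.
pose T v i k j l : R := sgb R (v (ordered_pair (i, j))) * sgb R (v (ordered_pair (j, k))) *
    (sgb R (v (ordered_pair (i, l))) * sgb R (v (ordered_pair (l, k)))).
have T1 v i k j l : T v i k j l <= 1.
  by rewrite (le_trans (ler_norm _))// !normrM !normr_sgb !mulr1.
have frobE v : frob2 (sign_mx v *m sign_mx v) =
    d%:R ^- 4 * \sum_i \sum_k \sum_j \sum_l T v i k j l.
  rewrite /frob2 big_distrr/=; apply: eq_bigr => i _.
  rewrite big_distrr/=; apply: eq_bigr => k _.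
  rewrite mxE expr2 big_distrlr/= big_distrr/=; apply: eq_bigr => j _.
  rewrite big_distrr/=; apply: eq_bigr => l _.
  by rewrite !mxE /T; field.
under eq_bigr do rewrite frobE.
rewrite -big_distrr/=.
have bound i k j l : \sum_(v : signs) T v i k j l <= #|{: signs}|%:R * ((i == k)%:R + (j == l)%:R).
  have triv : \sum_(v : signs) T v i k j l <= #|{: signs}|%:R.
    apply: (@le_trans _ _ (\sum_(v : signs) 1)); first by apply: ler_sum.
    by rewrite sumr_const.
  have [ik|ik] := boolP (i == k).
    by apply: (le_trans triv); rewrite ler_peMr// lerDl.
  have [jl|jl] := boolP (j == l).
    by apply: (le_trans triv); rewrite ler_peMr// lerDr.
  by rewrite /T sum_sign4// addr0 mulr0.
have swap : \sum_(v : signs) \sum_i \sum_k \sum_j \sum_l T v i k j l =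
    \sum_i \sum_k \sum_j \sum_l \sum_(v : signs) T v i k j l.
  rewrite exchange_big/=; apply: eq_bigr => i _.
  rewrite exchange_big/=; apply: eq_bigr => k _.
  rewrite exchange_big/=; apply: eq_bigr => j _.
  by rewrite exchange_big.
rewrite swap; apply: (@le_trans _ _ (d%:R ^- 4 * \sum_(i < d) \sum_(k < d) \sum_(j < d) \sum_(l < d)
   (#|{: signs}|%:R * ((i == k)%:R + (j == l)%:R)))).
  rewrite ler_wpM2l ?invr_ge0 ?exprn_ge0//.
  by do 4 (apply: ler_sum => ? _); exact: bound.
have one (m : 'I_d) : \sum_(l < d) (m == l)%:R = 1 :> R.
  by rewrite (bigD1 m)//= eqxx big1 ?addr0// => l /negPf; rewrite eq_sym => ->.
have cnt : \sum_(i < d) \sum_(k < d) \sum_(j < d) \sum_(l < d)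
   (#|{: signs}|%:R * ((i == k)%:R + (j == l)%:R)) = #|{: signs}|%:R * (2 * d%:R ^+ 3) :> R.
  have e1 (i k j : 'I_d) : \sum_(l < d) (#|{: signs}|%:R * ((i == k)%:R + (j == l)%:R)) =
     #|{: signs}|%:R * ((i == k)%:R * d%:R + 1) :> R.
    by rewrite -big_distrr/= big_split/= one sumr_const card_ord mulr_natr.
  under eq_bigr do under eq_bigr do under eq_bigr do rewrite e1.
  have e2 (i : 'I_d) : \sum_(k < d) \sum_(j < d)
     #|{: signs}|%:R * ((i == k)%:R * d%:R + 1) = #|{: signs}|%:R * (2 * d%:R ^+ 2) :> R.
    under eq_bigr do rewrite sumr_const card_ord -[_ *+ d]mulr_natr -mulrA.
    rewrite -big_distrr/= -big_distrl/= big_split/= -big_distrl/= one.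
    by rewrite sumr_const card_ord; ring.
  under eq_bigr do rewrite e2.
  by rewrite sumr_const card_ord -[LHS]mulr_natr; ring.
by rewrite cnt le_eqVlt; apply/orP; left; apply/eqP; field.
Qed.

(** The threshold is twice the bound on the mean, so Markov's inequality discards at most half of
    the signs. *)
Definition good_signs : {set signs} :=
  [set v | frob2 (sign_mx v *m sign_mx v) <= 4 / d%:R].

Lemma card_good_signs : #|{: signs}|%:R <= 2 * #|good_signs|%:R :> R.
Proof.
have dp : 0 < d%:R :> R by rewrite ltr0n.
have bad : #|~: good_signs|%:R * (4 / d%:R) <= #|{: signs}|%:R * (2 / d%:R) :> R.
  apply: le_trans sum_frob2_sqr_sign_mx.
  rewrite (bigID (mem (~: good_signs)))/= -[leLHS]addr0 lerD//; last first.
    by apply: sumr_ge0 => v _; exact: frob2_ge0.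
  rewrite mulr_natl -sumr_const; apply: ler_sum => v.
  by rewrite !inE -ltNge => /ltW.
have : #|{: signs}|%:R = #|good_signs|%:R + #|~: good_signs|%:R :> R.
  by rewrite -natrD cardsC.
move: bad; rewrite !mulrA ler_pM2r ?invr_gt0//; lra.
Qed.

End sign_prior.

(** With [w] frozen, both traces are quadratic forms in the signs of [v]. The entries of [B] all
    have modulus [1 / d], so the coefficients are at most [theta (C1 + C2) / d^2] for every [w],
    good or not. *)
Lemma sign_overlap_exp_moment (R : realType) (d : nat) (C1 C2 theta : R)
    (w : {ffun 'I_d * 'I_d -> bool}) :
  (0 < d)%N -> 0 <= C1 -> 0 <= C2 -> 0 <= theta -> 8 * (theta * (C1 + C2)) <= 1 / 16 ->
  \sum_(v : {ffun 'I_d * 'I_d -> bool})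
    expR (theta * d%:R ^+ 2 * (C1 * \tr (sign_mx R v *m sign_mx R w) ^+ 2 +
      C2 * \tr (sign_mx R v *m sign_mx R w *m (sign_mx R v *m sign_mx R w)))) <=
  #|{: {ffun 'I_d * 'I_d -> bool}}|%:R * expR 1.
Proof.
move=> d0 C10 C20 th0 hth; set B := sign_mx R w.
have dR0 : d%:R != 0 :> R by rewrite pnatr_eq0 -lt0n.
have sign_mxE (v : {ffun 'I_d * 'I_d -> bool}) i j : sign_mx R v i j = sgb R (v (ordered_pair (i, j))) / d%:R.
  by rewrite mxE.

pose c (x y : 'I_d * 'I_d) : R :=
  theta * (C1 * (B x.2 x.1 * B y.2 y.1) + C2 * (B x.2 y.1 * B y.2 x.1)).
have trE v : d%:R * \tr (sign_mx R v *m B) =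
    \sum_(x : 'I_d * 'I_d) sgb R (v (ordered_pair x)) * B x.2 x.1.
  transitivity (\sum_i \sum_j sgb R (v (ordered_pair (i, j))) * B j i); last first.
    by rewrite pair_bigA; apply: eq_bigr => -[].
  rewrite big_distrr/=; apply: eq_bigr => i _; rewrite mxE big_distrr/=.
  by apply: eq_bigr => j _; rewrite mxE; field.
have tr2E v : d%:R ^+ 2 * \tr (sign_mx R v *m B *m (sign_mx R v *m B)) =
    \sum_(x : 'I_d * 'I_d) \sum_(y : 'I_d * 'I_d)
      (B x.2 y.1 * B y.2 x.1) * (sgb R (v (ordered_pair x)) * sgb R (v (ordered_pair y))).
  transitivity (\sum_i \sum_j \sum_k \sum_l (B j k * B l i) *
      (sgb R (v (ordered_pair (i, j))) * sgb R (v (ordered_pair (k, l))))); last first.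
    rewrite pair_bigA; apply: eq_bigr => -[i j] _.
    by rewrite pair_bigA; apply: eq_bigr => -[].
  rewrite big_distrr/=; apply: eq_bigr => i _; rewrite -mulmxA mxE big_distrr/=.
  apply: eq_bigr => j _.
  rewrite [X in _ * (_ * X)]mxE !big_distrr/=; apply: eq_bigr => k _.
  rewrite [X in _ * (_ * (_ * X))]mxE !big_distrr/=; apply: eq_bigr => l _.
  by rewrite !sign_mxE; field.
have formE v : theta * d%:R ^+ 2 * (C1 * \tr (sign_mx R v *m B) ^+ 2 +
      C2 * \tr (sign_mx R v *m B *m (sign_mx R v *m B))) =
    \sum_x \sum_y c x y * (sgb R (v (ordered_pair x)) * sgb R (v (ordered_pair y))).
  have -> : theta * d%:R ^+ 2 * (C1 * \tr (sign_mx R v *m B) ^+ 2 +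
      C2 * \tr (sign_mx R v *m B *m (sign_mx R v *m B))) =
    theta * C1 * (d%:R * \tr (sign_mx R v *m B)) ^+ 2 +
    theta * C2 * (d%:R ^+ 2 * \tr (sign_mx R v *m B *m (sign_mx R v *m B))) by ring.
  rewrite trE tr2E expr2 big_distrlr/= !big_distrr/= -big_split/=.
  apply: eq_bigr => x _; rewrite !big_distrr/= -big_split/=.
  by apply: eq_bigr => y _; rewrite /c; ring.
under eq_bigr do rewrite formE.
pose K : R := theta * (C1 + C2) / d%:R ^+ 2.
apply: (@folded_chaos_exp_moment _ _ _ _ _ K).
- exact: ordered_pair_fibre.
- move=> x y; rewrite /c normrM ger0_norm// /K -mulrA ler_wpM2l//.
  apply: (le_trans (ler_normD _ _)).
  rewrite !normrM !normr_sign_mx// (ger0_norm C10) (ger0_norm C20).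
  by rewrite le_eqVlt; apply/orP; left; apply/eqP; field.
- by rewrite /K !mulr_ge0 ?addr_ge0// invr_ge0 exprn_ge0.
- rewrite card_prod !card_ord natrM /K.
  by apply: le_trans hth; rewrite le_eqVlt; apply/orP; left; apply/eqP; field.
Qed.

(** Convexity between 0 and [y], by the tangent at [w y]. It turns one bounded exponential moment at
    scale [theta d^2] into an excess proportional to [N / (theta d^2)]. *)
Lemma expR_interp (R : realType) (w y : R) : 0 <= w <= 1 ->
  expR (w * y) <= 1 + w * expR y.
Proof.
move=> /andP[w0 w1]; set z := w * y.
have tangent (a : R) : expR z * (1 + (a - z)) <= expR a.
  have -> : expR a = expR z * expR (a - z) by rewrite -expRD addrC subrK.
  by rewrite ler_wpM2l ?expR_ge0 ?expR_ge1Dx.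
have h0 := tangent 0; rewrite expR0 in h0.
have h1 := tangent y.
have ez0 : 0 <= expR z by exact: expR_ge0.
have : expR z * (w * (1 + (y - z)) + (1 - w) * (1 + (0 - z))) <= w * expR y + (1 - w) * 1.
  rewrite mulrDr lerD// mulrCA ler_wpM2l//; lra.
have -> : w * (1 + (y - z)) + (1 - w) * (1 + (0 - z)) = 1 by rewrite /z; ring.
lra.
Qed.

(** * Gaussian mixtures as contaminated Gaussians *)

(* With [kap = (1 - eps) / eps] and [a = 2 kap + 1], the contamination puts mass
   [p = kap (4 a^2 - 1) / (3 a^3)] at [- a] and [q = kap (a^2 - 1) / (6 a^3)] at
   [2 a]: these solve [a p - 2 a q = kap] and [a^3 p - 8 a^3 q = kap]. *)
Lemma exists_mixing_weights (R : realType) (eps : R) : 0 < eps <= 1 / 2 ->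
  exists (w s : 'I_4 -> R) (Lam : R),
  [/\ w ord0 = 1 - eps, s ord0 = 1, forall k, 0 <= w k & \sum_k w k = 1] /\
  [/\ \sum_k w k * s k = 0, \sum_k w k * s k ^+ 3 = 0, 1 <= Lam &
      forall k, `|s k| <= Lam].
Proof.
move=> /andP[e0 e1]; pose kap := (1 - eps) / eps.
have kap1 : 1 <= kap by rewrite ler_pdivlMr//; lra.
have epsk : eps * kap = 1 - eps by rewrite mulrC divfK// gt_eqF.
pose a := 2 * kap + 1; have a3 : 3 <= a by rewrite /a; lra.
have a0 : 0 < a by lra.
have a2 : 9 <= a ^+ 2 by nra.
have a_neq0 : a != 0 by rewrite gt_eqF.
pose p := kap * (4 * a ^+ 2 - 1) / (3 * a ^+ 3).
pose q := kap * (a ^+ 2 - 1) / (6 * a ^+ 3).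
have p0 : 0 <= p.
  by apply: divr_ge0; apply: mulr_ge0; rewrite ?exprn_ge0//; lra.
have q0 : 0 <= q.
  by apply: divr_ge0; apply: mulr_ge0; rewrite ?exprn_ge0//; lra.
(* The choice of [a] gives [kap / a <= 1 / 2], and so a total of at most [3 / 4]. *)
have pq : p + q <= 1.
  have -> : p + q = (kap / a) * ((9 * a ^+ 2 - 3) / (6 * a ^+ 2)).
    by rewrite /p /q; field.
  have h1 : kap / a <= 1 / 2 by rewrite ler_pdivrMr// /a; lra.
  have h2 : (9 * a ^+ 2 - 3) / (6 * a ^+ 2) <= 3 / 2.
    by rewrite ler_pdivrMr ?mulr_gt0 ?exprn_gt0//; have := sqr_ge0 a; lra.
  have h3 : 0 <= kap / a by rewrite divr_ge0 ?ltW//; lra.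
  have h4 : 0 <= (9 * a ^+ 2 - 3) / (6 * a ^+ 2).
    by apply: divr_ge0; lra.
  by apply: (le_trans (ler_pM h3 h4 h1 h2)); lra.
(* The fourth atom, at 0, takes the leftover mass without affecting any moment. *)
exists (fun k : 'I_4 => nth 0 [:: 1 - eps; eps * p; eps * q; eps * (1 - p - q)] k).
exists (fun k : 'I_4 => nth 0 [:: 1; - a; 2 * a; 0] k), (2 * a).
split; split => //.
- have e0' := ltW e0; move=> [[|[|[|[|k]]]] kk] //=; rewrite ?(mulr_ge0 e0')//; lra.
- by rewrite !big_ord_recl big_ord0 /=; ring.
- rewrite !big_ord_recl big_ord0 /= -epsk /p /q.
  by field.
- rewrite !big_ord_recl big_ord0 /= -epsk /p /q.
  by field.
- lra.
- move=> [[|[|[|[|k]]]] kk] //=; rewrite ?normr1 ?normrN ?normr0 ?ger0_norm ?mulr_ge0//; lra.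
Qed.

Lemma integral_fin_comb (d : measure_display) (T : measurableType d) (R : realType)
    (mu : {measure set T -> \bar R}) (K : finType) (c r : K -> R) (f : K -> T -> R) :
  (forall k, 0 <= c k) -> (forall k, measurable_fun setT (f k)) ->
  (forall k x, 0 <= f k x) -> (forall k, \int[mu]_x (f k x)%:E = (r k)%:E)%E ->
  (\int[mu]_x (\sum_k c k * f k x)%R%:E = (\sum_k c k * r k)%R%:E)%E.
Proof.
move=> c0 mf f0 fr; under eq_integral do rewrite -sumEFin.
rewrite ge0_integral_sum//; last 2 first.
- by move=> k; apply/measurable_EFinP; exact: measurable_funM.
- by move=> k x _; rewrite lee_fin mulr_ge0.
rewrite -sumEFin; apply: eq_bigr => k _.
under eq_integral do rewrite EFinM.
rewrite ge0_integralZl; first by rewrite fr.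
- by [].
- exact/measurable_EFinP.
- by move=> x _; rewrite lee_fin.
- by rewrite lee_fin.
Qed.

Section gaussian_mixtures.
Variables (R : realType) (d : nat) (P : probability (Rvec R d) R).
Hypothesis PE : forall (S : 'M[R]_d) (g : Rvec R d -> \bar R),
  measurable_fun [set: Rvec R d] g -> (forall x, 0 <= g x)%E ->
  gauss_int S g = (\int[P]_x (g x * (lratio S x)%:E))%E.

Lemma integral_lratio (S : 'M[R]_d) : posdef S -> (\int[P]_x (lratio S x)%:E = 1)%E.
Proof.
move=> Spd; rewrite -(gauss_int_cst1 Spd) PE//.
by apply: eq_integral => x _; rewrite mul1e.
Qed.

Lemma integral_lratioM (S S' : 'M[R]_d) :
  posdef S -> posdef S' -> posdef (invmx S + invmx S' - 1%:M) ->
  (\int[P]_x (lratio S x * lratio S' x)%:E =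
   ((Num.sqrt (\det (1%:M - (S - 1%:M) *m (S' - 1%:M))))^-1)%:E)%E.
Proof.
move=> Spd S'pd Kpd; rewrite -(gauss_int_lratio Spd S'pd Kpd) PE.
- by apply: eq_integral => x _; rewrite -EFinM mulrC.
- by apply/measurable_EFinP; exact: measurable_lratio.
- by move=> x; rewrite lee_fin lratio_ge0.
Qed.

Lemma exists_contamination (K : finType) (k0 : K) (w : K -> R) (S : K -> 'M[R]_d)
    (eps : R) :
  0 < eps -> w k0 = 1 - eps -> (forall k, 0 <= w k) -> \sum_k w k = 1 ->
  (forall k, posdef (S k)) ->
  exists B : probability (Rvec R d) R, forall g : Rvec R d -> \bar R,
  measurable_fun [set: Rvec R d] g -> (forall x, 0 <= g x)%E ->
  (contam_int eps (S k0) B g = \int[P]_x (g x * (\sum_k w k * lratio (S k) x)%R%:E))%E.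
Proof.
move=> e0 wk0 w0 w1 Spd.
have ew0 : 0 <= 1 - eps by rewrite -wk0.
(* The contamination carries the other atoms, renormalized by their total mass [eps]. *)
pose c k := if k == k0 then 0 else w k / eps.
have c0 k : 0 <= c k by rewrite /c; case: ifP => // _; rewrite divr_ge0// ltW.
pose h x := \sum_k c k * lratio (S k) x.
have mh : measurable_fun [set: Rvec R d] h.
  apply: measurable_sum => k; apply: measurable_funM => //; exact: measurable_lratio.
have h0 x : 0 <= h x by apply: sumr_ge0 => k _; rewrite mulr_ge0 ?lratio_ge0.
have sumc (y : K -> R) : eps * \sum_k c k * y k = \sum_k w k * y k - (1 - eps) * y k0.
  rewrite (bigD1 k0)//= [in RHS](bigD1 k0)//= /c eqxx mul0r add0r wk0 [RHS]addrC addKr.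
  rewrite big_distrr/=; apply: eq_bigr => k /negPf ->.
  by rewrite mulrA mulrCA divff ?gt_eqF// mulr1.
have h1 : (\int[P]_x (h x)%:E = 1)%E.
  rewrite (@integral_fin_comb _ _ _ _ _ _ (fun=> 1))//.
  - congr _%:E; apply: (mulfI (lt0r_neq0 e0)); rewrite sumc.
    rewrite (eq_bigr w) => [|k _]; last by rewrite mulr1.
    by rewrite w1; ring.
  - by move=> k; exact: measurable_lratio.
  - by move=> k x; exact: lratio_ge0.
  - by move=> k; exact: integral_lratio.
have [B BE] := exists_density_probability mh h0 h1.
exists B => g mg g0; rewrite /contam_int PE// BE//.
have ml : measurable_fun [set: Rvec R d] (lratio (S k0)) by exact: measurable_lratio.
have mgk (k : Rvec R d -> R) : measurable_fun [set: Rvec R d] k ->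
    measurable_fun [set: Rvec R d] (fun x => g x * (k x)%:E)%E.
  by move=> mk; apply: emeasurable_funM => //; exact/measurable_EFinP.
have gk0 (k : Rvec R d -> R) : (forall x, 0 <= k x) ->
    forall x, (0 <= g x * (k x)%:E)%E.
  by move=> k_ge0 x; rewrite mule_ge0// lee_fin.
have gZ (c' : R) (k : Rvec R d -> R) : 0 <= c' -> measurable_fun [set: Rvec R d] k ->
    (forall x, 0 <= k x) ->
    (c'%:E * \int[P]_x (g x * (k x)%:E) = \int[P]_x (c'%:E * (g x * (k x)%:E)))%E.
  move=> c'0 mk k_ge0; rewrite ge0_integralZl.
  - by [].
  - by [].
  - exact: mgk.
  - by move=> x _; exact: gk0.
  - by rewrite lee_fin.
have lr0 x : 0 <= lratio (S k0) x by exact: lratio_ge0.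
rewrite (gZ _ _ ew0 ml lr0) (gZ _ _ (ltW e0) mh h0) -ge0_integralD; first last.
- by apply: measurable_funeM; exact: mgk.
- by move=> x _; apply: mule_ge0; rewrite ?lee_fin ?(ltW e0)//; exact: gk0.
- by apply: measurable_funeM; exact: mgk.
- by move=> x _; apply: mule_ge0; rewrite ?lee_fin//; exact: gk0.
- by [].
apply: eq_integral => x _; rewrite !(muleCA _ (g x)) -!EFinM.
have h1' : (0 <= ((1 - eps) * lratio (S k0) x)%:E)%E by rewrite lee_fin (mulr_ge0 ew0).
have h2' : (0 <= (eps * h x)%:E)%E by rewrite lee_fin (mulr_ge0 (ltW e0)).
rewrite -(ge0_muleDr _ h1' h2').
congr (_ * _)%E; rewrite -EFinD; congr _%:E.
by rewrite /h (sumc (fun k => lratio (S k) x)); ring.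
Qed.

End gaussian_mixtures.

(** * Averaging over pairs of sign matrices, and the lower bound *)

Lemma sum_overlap_pow_lt (R : realType) (d N : nat) (C1 C2 theta : R)
    (G : {set {ffun 'I_d * 'I_d -> bool}})
    (rho : {ffun 'I_d * 'I_d -> bool} -> {ffun 'I_d * 'I_d -> bool} -> R) :
  (0 < d)%N -> 0 <= C1 -> 0 <= C2 -> 0 < theta -> 8 * (theta * (C1 + C2)) <= 1 / 16 ->
  #|{: {ffun 'I_d * 'I_d -> bool}}|%:R <= 2 * #|G|%:R :> R ->
  N%:R <= theta / (12 * (expR 1 * expR (16 * (theta * C1)))) * d%:R ^+ 2 ->
  (forall v u, v \in G -> u \in G -> 0 <= rho v u /\
    rho v u <= 1 + (C2 * \tr (sign_mx R v *m sign_mx R u *m (sign_mx R v *m sign_mx R u))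
       + C1 * (\tr (sign_mx R v *m sign_mx R u) ^+ 2 + (4 / d%:R) ^+ 2))) ->
  \sum_(v in G) \sum_(u in G) rho u v ^+ N < 4 / 3 * #|G|%:R ^+ 2.
Proof.
move=> d0 C10 C20 th0 hth Ghalf hN rhoP.
have dR0 : 0 < d%:R :> R by rewrite ltr0n.
have dneq0 : d%:R != 0 :> R by rewrite gt_eqF.
set E0 := expR (16 * (theta * C1)); pose E := expR 1 * E0.
have E1 : 1 <= E.
  rewrite /E /E0 -expRD (le_trans _ (expR_ge1Dx _))// lerDl addr_ge0//.
  by rewrite !mulr_ge0// ltW.
have Ep : 0 < E by lra.
pose om : R := N%:R / (theta * d%:R ^+ 2).
have td0 : 0 < theta * d%:R ^+ 2 by rewrite mulr_gt0 ?exprn_gt0.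
have om0 : 0 <= om by rewrite divr_ge0// ltW.
have omE : om * E <= 1 / 12.
  have : om <= 1 / (12 * E).
    rewrite ler_pdivrMr//; apply: (le_trans hN); rewrite -/E0 -/E.
    by rewrite le_eqVlt; apply/orP; left; apply/eqP; field; rewrite gt_eqF.
  have E12 : 0 < 12 * E by lra.
  by rewrite (ler_pdivlMr _ _ E12) => h; lra.
have om1 : om <= 1 by apply: (le_trans _ (le_trans omE _)); [rewrite ler_peMr|lra].
pose Y (v u : {ffun 'I_d * 'I_d -> bool}) : R :=
  theta * d%:R ^+ 2 * (C1 * \tr (sign_mx R v *m sign_mx R u) ^+ 2 +
      C2 * \tr (sign_mx R v *m sign_mx R u *m (sign_mx R v *m sign_mx R u))).
have powle v u : v \in G -> u \in G ->
    rho v u ^+ N <= 1 + om * (E0 * expR (Y v u)).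
  move=> vG uG; have [r0 r1] := rhoP v u vG uG.
  (* This is [rho^N <= exp (N (rho - 1))] with [N = om theta d^2]; the term [16 theta C1] is
     [theta d^2 C1 (4 / d)^2]. *)
  apply: (@le_trans _ _ (expR (om * (16 * (theta * C1) + Y v u)))); last first.
    by apply: le_trans (expR_interp _ _) _; rewrite ?om0// expRD.
  have -> : om * (16 * (theta * C1) + Y v u) = N%:R *
     (C2 * \tr (sign_mx R v *m sign_mx R u *m (sign_mx R v *m sign_mx R u))
       + C1 * (\tr (sign_mx R v *m sign_mx R u) ^+ 2 + (4 / d%:R) ^+ 2)).
    by rewrite /om /Y; field; rewrite dneq0 gt_eqF.
  rewrite expRM_natl lerXn2r ?nnegrE ?expR_ge0//.
  by apply: (le_trans r1); exact: expR_ge1Dx.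
(* The chaos bound needs independent signs, so the sum of exponentials over [G] is enlarged to all
   signs, at the price of a factor 2. *)
have rowle v : v \in G -> \sum_(u in G) rho u v ^+ N <= #|G|%:R * (1 + 2 * (om * E)).
  move=> vG; apply: (@le_trans _ _ (\sum_(u in G) (1 + om * (E0 * expR (Y u v))))).
    by apply: ler_sum => u uG; exact: powle.
  rewrite big_split/= sumr_const mulrDr mulr1 lerD2l -!big_distrr/=.
  apply: (@le_trans _ _ (om * (E0 * (#|{: {ffun 'I_d * 'I_d -> bool}}|%:R * expR 1)))).
    rewrite !ler_wpM2l ?expR_ge0//.
    apply: le_trans (sign_overlap_exp_moment v d0 C10 C20 (ltW th0) hth).
    rewrite [leRHS](bigID (mem G))/= lerDl; apply: sumr_ge0 => u _; exact: expR_ge0.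
  have -> : om * (E0 * (#|{: {ffun 'I_d * 'I_d -> bool}}|%:R * expR 1)) =
      #|{: {ffun 'I_d * 'I_d -> bool}}|%:R * (om * E) by rewrite /E; ring.
  apply: (le_trans (ler_wpM2r _ Ghalf)); first by rewrite mulr_ge0// ltW.
  by rewrite le_eqVlt; apply/orP; left; apply/eqP; ring.
have G0 : 0 < #|G|%:R :> R.
  have : 0 < #|{: {ffun 'I_d * 'I_d -> bool}}|%:R :> R.
    by rewrite ltr0n; apply/card_gt0P; exists [ffun=> true].
  lra.
apply: (@le_lt_trans _ _ (\sum_(v in G) #|G|%:R * (1 + 2 * (om * E)))).
  by apply: ler_sum => v vG; exact: rowle.
(* As [om E <= 1 / 12], the relative excess is at most [1 / 6], below the admissible [1 / 3]. *)
rewrite sumr_const -[X in X < _]mulr_natr.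
have : 0 < #|G|%:R ^+ 2 :> R by rewrite exprn_gt0.
have -> : #|G|%:R * (1 + 2 * (om * E)) * #|G|%:R = #|G|%:R ^+ 2 * (1 + 2 * (om * E)) by ring.
nra.
Qed.

Unset Implicit Arguments.

Theorem theorem1 (R : realType) :
  exists eps0 : R, 0 < eps0 /\
  forall eps : R, 0 < eps <= eps0 ->
  exists (c : R) (d_eps : nat), 0 < c /\
  forall (d N : nat), (d_eps <= d)%N -> N%:R <= c * d%:R ^+ 2 ->
  forall f : N.-tuple (Rvec R d) -> R,
    measurable_fun setT f -> (forall x, 0 <= f x <= 1) ->
  ~ ( (* (i) Pr_{x ~ N(0,I)^N}[f(x) = 0] >= 2/3 *)
      (prod_int (gauss_int (1%:M : 'M[R]_d)) N (fun x => (1 - f x)%:E)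
         >= (2 / 3 : R)%:E)%E
    /\
      (* (ii) for all Sigma > 0 with ||Sigma - I||_F > 1/2 and all B,
              Pr_{x ~ Z^N}[f(x) = 1] >= 2/3, Z = (1-eps) N(0,Sigma) + eps B *)
      (forall (S : 'M[R]_d), posdef S -> frob (S - 1%:M) > 1 / 2 ->
       forall B : probability (Rvec R d) R,
       (prod_int (contam_int eps S B) N (fun x => (f x)%:E)
          >= (2 / 3 : R)%:E)%E) ).
Proof.
exists (1 / 2); split; first by rewrite divr_gt0.
move=> eps heps; have /andP[e0 e1] := heps.
have [w [s [Lam [[wk0 sk0 w0 w1] [ws1 ws3 Lam1 sLam]]]]] := exists_mixing_weights heps.
have [C [C0 overlap]] := exists_lratio_overlap_const Lam1.
pose C2 : R := (\sum_k w k * s k ^+ 2) ^+ 2 / 4.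
have C20 : 0 <= C2 by rewrite divr_ge0 ?sqr_ge0.
(* The factor [128 = 8 * 16] meets the smallness condition of the chaos bound; the added 1 keeps the
   denominator positive. *)
pose theta : R := (128 * (C + C2 + 1))^-1.
have th0 : 0 < theta by rewrite invr_gt0; lra.
have hth : 8 * (theta * (C + C2)) <= 1 / 16.
  rewrite /theta mulrA mulrAC ler_pdivrMr; last by lra.
  by lra.
have L0 : 0 <= 100 * Lam ^+ 4 by rewrite mulr_ge0// exprn_ge0//; lra.
(* The dimension bound yields [Lam^4 (4 / d) <= 1 / 25], and its successor yields [d > 0]. Both
   constants depend on [eps] alone, through the weights. *)
exists (theta / (12 * (expR 1 * expR (16 * (theta * C))))), (Num.bound (100 * Lam ^+ 4)).+1.
split; first by rewrite divr_gt0// !mulr_gt0// expR_gt0.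
move=> d N dle hN f mf f01 [Hi Hii].
have d0 : (0 < d)%N by exact: leq_trans dle.
have dR0 : 0 < d%:R :> R by rewrite ltr0n.
have Lampsi : Lam ^+ 4 * (4 / d%:R) <= 1 / 25.
  have : 100 * Lam ^+ 4 <= d%:R.
    apply: (le_trans (ltW (archi_boundP L0))); rewrite ler_nat; exact: ltnW.
  by move=> h; rewrite [leLHS]mulrA ler_pdivrMr//; lra.
have [P PE] := exists_gauss_lratio R d.
pose signs := {ffun 'I_d * 'I_d -> bool}.
pose A (v : signs) : 'M[R]_d := sign_mx R v.
pose S (v : signs) k : 'M[R]_d := 1%:M + s k *: A v.
have S_overlap v u k l : v \in good_signs R d -> u \in good_signs R d ->
    let M := A v *m A u in
    [/\ posdef (S v k), posdef (S u l), posdef (invmx (S v k) + invmx (S u l) - 1%:M) &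
     (Num.sqrt (\det (1%:M - (S v k - 1%:M) *m (S u l - 1%:M))))^-1 <=
      1 + (s k * s l) * \tr M / 2 + (s k * s l) ^+ 2 * \tr (M *m M) / 4
      + (s k * s l) ^+ 3 * \tr (M *m M *m M) / 6
      + C * (\tr M ^+ 2 + (4 / d%:R) ^+ 2)].
  rewrite !inE => vG uG M.
  by apply: overlap => //; rewrite ?sign_mx_sym ?frob2_sign_mx.
(* The second moment method wants a law for every index, and positive definiteness is known only for
   good signs: hence a subtype. *)
pose V := {v : signs | v \in good_signs R d}.
pose L (v : V) (x : Rvec R d) : R := \sum_k w k * lratio (S (val v) k) x.
have Spd (v : V) k : posdef (S (val v) k).
  by have [] := S_overlap _ _ k k (valP v) (valP v).
have contam (v : V) : exists B : probability (Rvec R d) R,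
    forall g : Rvec R d -> \bar R, measurable_fun [set: Rvec R d] g -> (forall x, 0 <= g x)%E ->
    (contam_int eps (S (val v) ord0) B g = \int[P]_x (g x * (L v x)%:E))%E.
  exact: (exists_contamination PE e0 wk0 w0 w1 (Spd v)).
pose B v := projT1 (cid (contam v)).
have BE v := projT2 (cid (contam v)); rewrite -/(B _) in BE.
pose rho (v u : signs) : R := \sum_k \sum_l w k * w l *
  (Num.sqrt (\det (1%:M - (S v k - 1%:M) *m (S u l - 1%:M))))^-1.
have rho0 v u : 0 <= rho v u.
  by do 2 (apply: sumr_ge0 => ? _); rewrite !mulr_ge0// invr_ge0 sqrtr_ge0.
have size_V : size (enum {: V}) = #|good_signs R d| by rewrite -cardE card_sig.
have G0 : (0 < #|good_signs R d|)%N.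
  have := card_good_signs R d0; rewrite lt0n; apply: contraTneq => ->.
  rewrite mulr0 -ltNge ltr0n; apply/card_gt0P; by exists [ffun=> true].
apply: (@second_moment_method _ _ R P V (enum {: V}) L (gauss_int (1%:M : 'M[R]_d))
  (fun v => contam_int eps (S (val v) ord0) (B v)) (fun v u => rho (val v) (val u)) N f).
- move=> v; apply: measurable_sum => k; apply: measurable_funM => //.
  exact: measurable_lratio.
- by move=> v x; apply: sumr_ge0 => k _; rewrite mulr_ge0// lratio_ge0.
- move=> v; rewrite (@integral_fin_comb _ _ _ _ _ _ (fun=> 1))//.
  + by congr _%:E; rewrite -[RHS]w1; apply: eq_bigr => k _; rewrite mulr1.
  + by move=> k; exact: measurable_lratio.
  + by move=> k x; exact: lratio_ge0.
  + by move=> k; exact: (integral_lratio PE).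
- move=> g mg g0; rewrite PE//; apply: eq_integral => x _.
  by rewrite /lratio divff ?mule1// gt_eqF// gauss_density1_gt0.
- exact: BE.
- move=> v u; transitivity (\int[P]_x (\sum_(p : 'I_4 * 'I_4) w p.1 * w p.2 *
      (lratio (S (val v) p.1) x * lratio (S (val u) p.2) x))%R%:E)%E.
    apply: eq_integral => x _; congr _%:E; rewrite /L big_distrlr/= pair_bigA/=.
    by apply: eq_bigr => p _; ring.
  rewrite (@integral_fin_comb _ _ _ _ _ _ (fun p : 'I_4 * 'I_4 => (Num.sqrt (\det
     (1%:M - (S (val v) p.1 - 1%:M) *m (S (val u) p.2 - 1%:M))))^-1)).
  + by rewrite /rho pair_bigA.
  + by move=> p; rewrite mulr_ge0.
  + by move=> p; apply: measurable_funM; exact: measurable_lratio.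
  + by move=> p x; rewrite mulr_ge0 ?lratio_ge0.
  + move=> p; have [? ? ? _] := S_overlap _ _ p.1 p.2 (valP v) (valP u).
    exact: (integral_lratioM PE).
- by move=> v u; exact: rho0.
- by rewrite size_V.
- rewrite size_V; have -> : \sum_(v <- enum {: V}) \sum_(u <- enum {: V})
      rho (val v) (val u) ^+ N =
    \sum_(v in good_signs R d) \sum_(u in good_signs R d) rho u v ^+ N.
    rewrite exchange_big/= big_enum/= [RHS]big_sub/=; apply: eq_bigr => v _.
    by rewrite big_enum/= [RHS]big_sub/=.
  apply: (sum_overlap_pow_lt d0 C0 C20 th0 hth (card_good_signs R d0) hN) => v u vG uG.
  split; first exact: rho0.
  pose M := A v *m A u; rewrite addrA.
  apply: (@mixture_overlap_le _ _ w s C (\tr M) (\tr (M *m M)) (\tr (M *m M *m M))) => // k l.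
  by have [_ _ _] := S_overlap v u k l vG uG; apply.
- exact: mf.
- exact: f01.
- exact: Hi.
(* Since [s ord0 = 1], the covariance lies at Frobenius distance exactly 1 from the identity. *)
- move=> v; apply: Hii; first exact: Spd.
  rewrite /S sk0 scale1r addrC addKr.
  by rewrite frob_sqrt frob2_sign_mx// sqrtr1; lra.
Qed.
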